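(* Let $W=I_2(k)$ with $k\in\{2,3,4,6\}$ (i.e. the Weyl groups of types $A_1\times A_1$, $A_2$, $B_2$, $G_2$), and let $m\ge1$. Then $$\operatorname{Cat}^{(m)}(W;q,1)=\sum_R q^{\operatorname{coh}(R)},$$ where the sum ranges over all positive regions $R$ of the extended Shi arrangement $\mathsf{Shi}^{(m)}(W)$.
   Context: $\operatorname{Cat}^{(m)}(W;q,t)$ is the bigraded Hilbert series of $\mathcal{A}^m/\langle\mathbf{x},\mathbf{y}\rangle\mathcal{A}^m$, where $W$ acts diagonally (identically) on the variables $(x_1,x_2)$, $(y_1,y_2)$ of $\mathbb{C}[\mathbf{x},\mathbf{y}]$, $\mathcal{A}$ is the ideal generated by all polynomials $p$ with $\omega(p)=\det(\omega)p$ for all $\omega\in W$, $\langle\mathbf{x},\mathbf{y}\rangle$ is the ideal of polynomials without constant term, $q$ marks $\mathbf{x}$-degree and $t$ marks $\mathbf{y}$-degree. For a crystallographic $W$ with positive roots $\Phi^+$ in a real Euclidean space $V$ ($N=|\Phi^+|$), $\mathsf{Shi}^{(m)}(W)$ consists of the hyperplanes $H^{(j)}_\alpha=\{x:(\alpha,x)=j\}$ for $\alpha\in\Phi^+$, $-m<j\le m$; a region is a connected component of the complement; it is positive if contained in $\{x:(\alpha,x)>0\ \forall\alpha\in\Phi^+\}$. With $R^0=\{x:0<(\alpha,x)<1\ \forall\alpha\in\Phi^+\}$, $\operatorname{height}(R)$ is the number of hyperplanes of $\mathsf{Shi}^{(m)}(W)$ separating $R$ from $R^0$, and $\operatorname{coh}(R)=mN-\operatorname{height}(R)$.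 *)

(* Defs.v *)
(* Multinomials' mpoly must be Imported
   BEFORE mathcomp-analysis to avoid a notation-level clash. *)
From HB Require Import structures.
From mathcomp Require Import all_boot all_order all_algebra.
From mathcomp Require Import mpoly.
From mathcomp Require Import all_classical all_reals all_analysis.
From mathcomp.real_closed Require Import complex.

Set Implicit Arguments.
Unset Strict Implicit.
Unset Printing Implicit Defensive.

Import Order.TTheory GRing.Theory Num.Theory.
Import numFieldNormedType.Exports.
Local Open Scope ring_scope.
Local Open Scope classical_set_scope.

(* The crystallographic dihedral root systems I_2(k), k in {2,3,4,6},        *)
(* given by their Cartan matrix a_ij = <alpha_i^vee, alpha_j>:               *)
(*   k=2 : A1 x A1,  k=3 : A2,  k=4 : B2 (alpha_1 short),                    *)
(*   k=6 : G2 (alpha_1 short).                                               *)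
(* V is identified with R^2 via the basis of simple roots (for the action    *)
(* of W) resp. via x |-> ((alpha_1,x),(alpha_2,x)) (for the Shi side).      *)

Definition cartan (k : nat) : 'M[int]_2 :=
  \matrix_(i < 2, j < 2)
    if i == j then 2%:Z
    else if k == 3%N then -(1%:Z)
    else if k == 4%N then (if i == ord0 then -(2%:Z) else -(1%:Z))
    else if k == 6%N then (if i == ord0 then -(3%:Z) else -(1%:Z))
    else 0%:Z.

(* simple reflection s_i acting on coordinate columns w.r.t. the simple
   roots: s_i(alpha_j) = alpha_j - a_ij alpha_i *)
Definition simple_refl (k : nat) (i : 'I_2) : 'M[int]_2 :=
  1%:M - delta_mx i i *m cartan k.

(* The Weyl group W = I_2(k), as the group of matrices generated by the
   simple reflections (a finite group generated by involutions, so the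
   generated monoid is the generated group). *)
Definition weyl (k : nat) : set 'M[int]_2 :=
  [set M | exists s : seq 'I_2, M = \prod_(i <- s) simple_refl k i].

Definition simple_root (i : 'I_2) : 'cV[int]_2 := delta_mx i 0.

Definition roots (k : nat) : set 'cV[int]_2 :=
  [set b | exists M i, weyl k M /\ b = M *m simple_root i].

Definition posroots (k : nat) : set 'cV[int]_2 :=
  [set b | roots k b /\ forall i : 'I_2, 0 <= b i 0].

(* The q,t-Catalan side: C[x,y] = C[x1,x2,y1,y2], C = R[i].                  *)
(* Variables 0,1 are x1,x2 and variables 2,3 are y1,y2.                      *)

Section Cat.
Variable R : realType.

Local Notation Pol := (mpoly.mpoly 4 R[i]).

Definition pvar (i : nat) : Pol := mpoly.mpolyX _ (mpoly.mnm1 (inord i)).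

(* substitution p(x,y) |-> p(Mx, My): the (diagonal) action of M^{-1} *)
Definition wact (M : 'M[int]_2) (p : Pol) : Pol :=
  mpoly.comp_mpoly
    [tuple (if (i < 2)%N
            then \sum_(j < 2) ((M (inord i) j)%:~R : R[i]) *: pvar j
            else \sum_(j < 2) ((M (inord (i - 2)) j)%:~R : R[i]) *: pvar (j + 2))
     | i < 4] p.

Definition alternating (k : nat) : set Pol :=
  [set p | forall M, weyl k M -> wact M p = ((\det M)%:~R : R[i]) *: p].

Definition ideal_gen (S : set Pol) : set Pol :=
  [set p | exists (n : nat) (r f : 'I_n -> Pol),
             (forall j, S (f j)) /\ p = \sum_(j < n) r j * f j].

Definition ideal_mul (I J : set Pol) : set Pol :=
  ideal_gen [set h | exists f g, I f /\ J g /\ h = f * g].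

Definition ideal_pow (I : set Pol) (m : nat) : set Pol :=
  iter m (ideal_mul I) [set: Pol].

Definition altideal (k : nat) : set Pol := ideal_gen (alternating k).

Definition maxideal : set Pol :=
  [set p | mpoly.mcoeff (@mpoly.mnm0 4) p = 0].

Definition bihom (a b : nat) (p : Pol) : Prop :=
  forall mn, mn \in mpoly.msupp p ->
    (mn (inord 0) + mn (inord 1) = a /\ mn (inord 2) + mn (inord 3) = b)%N.

Definition quot_dim_is (k m a b d : nat) : Prop :=
  let Am := ideal_pow (altideal k) m in
  let Nm := ideal_mul maxideal Am in
  exists f : 'I_d -> Pol,
    [/\ forall j, Am (f j) /\ bihom a b (f j),
        forall c : 'I_d -> R[i], Nm (\sum_(j < d) c j *: f j) -> forall j, c j = 0
      & forall p, Am p -> bihom a b p ->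
          exists c : 'I_d -> R[i], Nm (p - \sum_(j < d) c j *: f j)].

Definition quot_dim (k m a b : nat) : nat :=
  xget 0%N [set d | quot_dim_is k m a b d].

(* Cat^(m)(W;q,t) as a polynomial in t (outer) with coefficients in Z[q] *)
Definition Cat (k m : nat) : {poly {poly int}} :=
  \sum_(ab \in [set: nat * nat])
     ((quot_dim k m ab.1 ab.2)%:R * ('X^(ab.1) : {poly int})%:P * 'X^(ab.2)).

Definition Cat_q1 (k m : nat) : {poly int} := (Cat k m).[1].

(* The extended Shi arrangement in V = R^2, coordinates x_i = (alpha_i, x).  *)

Definition pairing (a : 'cV[int]_2) (x : 'rV[R]_2) : R :=
  \sum_(i < 2) (a i 0)%:~R * x 0 i.

Definition shi_hyps (k m : nat) : set ('cV[int]_2 * int) :=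
  [set aj | posroots k aj.1 /\ (- (m%:Z) < aj.2 <= m%:Z)].

Definition shi_complement (k m : nat) : set 'rV[R]_2 :=
  [set x | forall aj, shi_hyps k m aj -> pairing aj.1 x != aj.2%:~R].

Definition shi_regions (k m : nat) : set (set 'rV[R]_2) :=
  [set connected_component (shi_complement k m) x | x in shi_complement k m].

Definition dominant_cone (k : nat) : set 'rV[R]_2 :=
  [set x | forall a, posroots k a -> 0 < pairing a x].

Definition pos_shi_regions (k m : nat) : set (set 'rV[R]_2) :=
  [set Rg | shi_regions k m Rg /\ Rg `<=` dominant_cone k].

Definition fund_alcove (k : nat) : set 'rV[R]_2 :=
  [set x | forall a, posroots k a -> 0 < pairing a x < 1].

Definition separates (k : nat) (Rg : set 'rV[R]_2) (aj : 'cV[int]_2 * int) : Prop :=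
  (Rg `<=` [set x | pairing aj.1 x < aj.2%:~R] /\
   fund_alcove k `<=` [set x | aj.2%:~R < pairing aj.1 x]) \/
  (Rg `<=` [set x | aj.2%:~R < pairing aj.1 x] /\
   fund_alcove k `<=` [set x | pairing aj.1 x < aj.2%:~R]).

Definition height (k m : nat) (Rg : set 'rV[R]_2) : nat :=
  \sum_(aj \in shi_hyps k m `&` separates k Rg) 1%N.

Definition nposroots (k : nat) : nat := \sum_(a \in posroots k) 1%N.

Definition coh (k m : nat) (Rg : set 'rV[R]_2) : nat :=
  (m * nposroots k - height k m Rg)%N.

Definition shi_coh_sum (k m : nat) : {poly int} :=
  \sum_(Rg \in pos_shi_regions k m) ('X^(coh k m Rg) : {poly int}).

End Cat.

(* Main.v *)
Require Import Defs.
From HB Require Import structures.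
From mathcomp Require Import all_boot all_order all_algebra.
From mathcomp Require Import mpoly.
From mathcomp Require Import all_classical all_reals all_analysis.
From mathcomp.real_closed Require Import complex.
From mathcomp Require Import zify ring lra.

Set Implicit Arguments.
Unset Strict Implicit.
Unset Printing Implicit Defensive.

Import Order.TTheory GRing.Theory Num.Theory.
Import numFieldNormedType.Exports.
Local Open Scope ring_scope.

(** Catalan side.  In coordinates [U, V] diagonalising the Coxeter element, the
    ideal [A] is generated by [D = U1 V2 - V1 U2] and the
    [E a = U1^a U2^(k-a) - V1^a V2^(k-a)].  Since
    [E a * E (b+1) - E (a+1) * E b] lies in [D * A], a product of [j] factors [E]
    depends, modulo [D * A^j], only on the sum [c] of its indices; hence [A^m] is
    generated by one element of bidegree [(m-j+c, m-j+jk-c)] for each [j <= m] and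
    [c <= jk].  Specialising [U1 = U2 = t], [V1 = 0], [V2 = t s] and comparing
    powers of [s] shows that these generators are minimal.

    Shi side.  Put [x = (alpha_1, .)] and [y = (alpha_2, .)].  All walls cross at
    integral or, for [k = 6], half-integral [y].  Along a horizontal line in the
    strip [n < y < n+1] the height grows by one at each wall, so the regions met
    there have pairwise distinct consecutive heights; any other region of the strip
    touches a crossing at [y = n + 1/2] from above.  For [k = 6] these extra regions
    are indexed by pairs [(v, s)] with [s < min(v, m - v)], the height being
    [5 v + s].  After multiplication by [1 - q] both sums telescope. *)

(** At [t = 1] the generators belonging to one [j] sum, after multiplication by [1 - q], to
    [q^(m - j) - q^(m + (k - 1) j + 1)]. The regions met by the line in the strip [n = m - j] have
    heights up to [(k - 1) m + n], which accounts for the first power; the second asks for a lowest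
    height [(k - 1) n]. For [k < 6] this is the lowest height. For [k = 6] the root
    [3 alpha_1 + 2 alpha_2] has already passed [min(m, 2 n)] walls near [x = 0], not [n], so the
    line starts at height [5 n + min(n, m - n)]. The extra regions with [v = n] have exactly the
    missing heights, although they lie in lower strips: this is the origin of the pairs [(v, s)].

    For [k = 2] all generators have total degree [2 m], so degree alone cannot separate them; the
    power of [s] counts the factors [D] and does.

    The list of regions is complete because a region that shares strip and height with a region on
    the line, but lies on other sides of some walls, exhibits two walls that cross inside the strip;
    a check over pairs of roots leaves two kinds of crossing. *)

Section Ideals.
Variable P : comNzRingType.
Implicit Types (S I J : set P).

Definition is_ideal I : Prop :=
  [/\ I 0, forall x y, I x -> I y -> I (x + y) & forall r x, I x -> I (r * x)].

(** The formula of [ideal_gen] over any commutative ring. At the polynomial ring the two agree by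
    conversion, so that results on [igen], [imul] and [ipow] apply to [altideal] and its powers. *)
Definition igen S : set P :=
  [set p | exists (n : nat) (r f : 'I_n -> P),
             (forall j, S (f j)) /\ p = \sum_(j < n) r j * f j].

Definition imul I J : set P := igen [set h | exists f g, I f /\ J g /\ h = f * g].

Definition ipow I m : set P := iter m (imul I) (@classical_sets.setT P).

Lemma ideal_sum I (T : Type) (s : seq T) (Q : pred T) (f : T -> P) :
  is_ideal I -> (forall i, Q i -> I (f i)) -> I (\sum_(i <- s | Q i) f i).
Proof. by case=> I0 ID _ If; apply: big_rec => // i x Qi Ix; apply: ID => //; apply: If. Qed.

Lemma ideal_opp I x : is_ideal I -> I x -> I (- x).
Proof. by case=> _ _ IM Ix; rewrite -mulN1r; apply: IM. Qed.

Lemma igen_ideal S : is_ideal (igen S).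
Proof.
split.
- by exists 0%N, (fun=> 0), (fun=> 0); split=> [[]//|]; rewrite big_ord0.
- move=> x y [n1 [r1 [f1 [S1 ->]]]] [n2 [r2 [f2 [S2 ->]]]].
  exists (n1 + n2)%N.
  exists (fun i => match fintype.split i with inl j => r1 j | inr j => r2 j end).
  exists (fun i => match fintype.split i with inl j => f1 j | inr j => f2 j end).
  split; first by move=> i; case: fintype.split.
  rewrite big_split_ord /=; congr (_ + _); apply: eq_bigr => i _.
    by rewrite (unsplitK (inl _ i)).
by rewrite (unsplitK (inr _ i)).
- move=> r x [n [s [f [Sf ->]]]]; exists n, (fun i => r * s i), f; split=> //.
  by rewrite mulr_sumr; apply: eq_bigr => i _; rewrite mulrA.
Qed.

Lemma igen_mem S x : S x -> igen S x.
Proof.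
by move=> Sx; exists 1%N, (fun=> 1), (fun=> x); split=> //; rewrite big_ord1 mul1r.
Qed.

Lemma igen_min S I : is_ideal I -> (forall x, S x -> I x) -> forall x, igen S x -> I x.
Proof.
move=> iI SI x [n [r [f [Sf ->]]]]; apply: ideal_sum => // i _.
by have [_ _ IM] := iI; apply: IM; apply: SI.
Qed.

Lemma igen_sub S S' : (forall x, S x -> igen S' x) -> forall x, igen S x -> igen S' x.
Proof. by move=> SS; apply: igen_min SS; apply: igen_ideal. Qed.

Lemma imul_min I J K : is_ideal K -> (forall x y, I x -> J y -> K (x * y)) ->
  forall x, imul I J x -> K x.
Proof. by move=> iK IJK; apply: igen_min => // _ [x [y [Ix [Jy ->]]]]; apply: IJK. Qed.

Lemma imul_mem I J x y : I x -> J y -> imul I J (x * y).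
Proof. by move=> Ix Jy; apply: igen_mem; exists x, y. Qed.

Lemma ipow_ideal I m : is_ideal (ipow I m).
Proof. by case: m => [|m]; [split | apply: igen_ideal]. Qed.

Lemma principal_ideal (d : P) : is_ideal [set x | exists y, x = d * y].
Proof.
split=> /=; first by exists 0; rewrite mulr0.
  by move=> _ _ [x ->] [y ->]; exists (x + y); rewrite mulrDr.
by move=> r _ [x ->]; exists (r * x); rewrite mulrCA.
Qed.

End Ideals.

(** * Generators of the powers of the ideal *)

Section Generators.
Variables (P : comNzRingType) (U1 U2 V1 V2 : P).

Definition Dgen : P := U1 * V2 - V1 * U2.
Definition Egen (k a : nat) : P :=
  U1 ^+ a * U2 ^+ (k - a) - V1 ^+ a * V2 ^+ (k - a).

(** The canonical product of [j] factors [Egen] with index sum [c <= j * k]: the indices are filled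
    greedily with [k], then one remainder, then zeros. *)
Fixpoint Fgen (k j c : nat) : P :=
  if j is i.+1 then Egen k (minn k c) * Fgen k i (c - k) else 1.

Definition Ggen (k m j c : nat) : P := Dgen ^+ (m - j) * Fgen k j c.

Definition mono4 (a1 a2 b1 b2 : nat) : P :=
  U1 ^+ a1 * U2 ^+ a2 * V1 ^+ b1 * V2 ^+ b2.

(* For [k = 0] the congruence is an equality and [Egen 0 0 = 0], so the ideal
   may then be the principal ideal of [Dgen]. *)
Lemma mono4_swap k (I : set P) a1 a2 b1 b2 : is_ideal I -> I Dgen ->
  (forall a, (a <= k)%N -> I (Egen k a)) ->
  (a1 + a2 = b1 + b2 %[mod k])%N ->
  I (mono4 a1 a2 b1 b2 - mono4 b1 b2 a1 a2).
Proof.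
move=> iI ID IE; have [I0 IA IM] := iI.
have vfree n : forall a1 a2, (a1 + a2 <= n)%N -> (k %| a1 + a2)%N ->
    I (U1 ^+ a1 * U2 ^+ a2 - V1 ^+ a1 * V2 ^+ a2).
  elim: n => [|n IHn] x y; first by case: x y => [|?] [|?] //= _ _; rewrite subrr.
  move=> le_n kd; have [k0|k0] := posnP k.
    move: kd; rewrite k0 dvd0n addn_eq0 => /andP[/eqP-> /eqP->].
    by rewrite subrr.
  have [xy0|xy0] := posnP (x + y).
    by move/eqP: xy0; rewrite addn_eq0 => /andP[/eqP-> /eqP->]; rewrite subrr.
  have kle : (k <= x + y)%N by apply: dvdn_leq.
  (* A factor of degree exactly [k] is split off, with as many [U1] as are available; [k <= x + y]
     leaves enough [U2] for the rest. *)
  pose a := minn k x.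
  have Ex : x = (a + (x - a))%N by rewrite /a; lia.
  have Ey : y = ((k - a) + (y - (k - a)))%N by rewrite /a; lia.
  have -> : U1 ^+ x * U2 ^+ y - V1 ^+ x * V2 ^+ y =
     (U1 ^+ (x - a) * U2 ^+ (y - (k - a))) * Egen k a + V1 ^+ a * V2 ^+ (k - a) *
     (U1 ^+ (x - a) * U2 ^+ (y - (k - a)) - V1 ^+ (x - a) * V2 ^+ (y - (k - a))).
    rewrite {1 2}Ex {1 2}Ey !exprD /Egen; ring.
  apply: IA; first by apply/IM/IE; rewrite /a; lia.
  apply/IM/IHn; first by rewrite /a; lia.
  have -> : (x - a + (y - (k - a)) = x + y - k)%N by rewrite /a; lia.
  exact: dvdn_sub.
(* Each reduction lowers the degree in [U] and the degree in [V] by one, which preserves their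
   congruence modulo [k]: common factors [U1 V1] or [U2 V2] are divided out, and a mixed pair is
   exchanged at the cost of a multiple of [Dgen]. It ends at monomials in [U] alone or [V] alone,
   the case of [vfree]. *)
have step1 x1 x2 y1 y2 : mono4 x1.+1 x2 y1.+1 y2 - mono4 y1.+1 y2 x1.+1 x2 =
    (U1 * V1) * (mono4 x1 x2 y1 y2 - mono4 y1 y2 x1 x2).
  rewrite /mono4 !exprS.
  move: (U1 ^+ _) (U1 ^+ _) (U2 ^+ _) (U2 ^+ _) (V1 ^+ _) (V1 ^+ _) (V2 ^+ _) (V2 ^+ _) => *.
  ring.
have step2 x1 x2 y1 y2 : mono4 x1 x2.+1 y1 y2.+1 - mono4 y1 y2.+1 x1 x2.+1 =
    (U2 * V2) * (mono4 x1 x2 y1 y2 - mono4 y1 y2 x1 x2).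
  rewrite /mono4 !exprS.
  move: (U1 ^+ _) (U1 ^+ _) (U2 ^+ _) (U2 ^+ _) (V1 ^+ _) (V1 ^+ _) (V2 ^+ _) (V2 ^+ _) => *.
  ring.
have step3 x y : mono4 0 x.+1 y.+1 0 - mono4 y.+1 0 0 x.+1 =
    (U2 * V1) * (mono4 0 x y 0 - mono4 y 0 0 x) + (- mono4 y 0 0 x) * Dgen.
  rewrite /mono4 /Dgen !exprS !expr0.
  move: (U1 ^+ _) (U2 ^+ _) (V1 ^+ _) (V2 ^+ _) => *.
  ring.
have step4 x y : mono4 x.+1 0 0 y.+1 - mono4 0 y.+1 x.+1 0 =
    (U2 * V1) * (mono4 x 0 0 y - mono4 0 y x 0) + mono4 x 0 0 y * Dgen.
  rewrite /mono4 /Dgen !exprS !expr0.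
  move: (U1 ^+ _) (U2 ^+ _) (V1 ^+ _) (V2 ^+ _) => *.
  ring.
move: {2}(a1 + a2 + b1 + b2)%N (leqnn (a1 + a2 + b1 + b2)%N) => n.
elim: n a1 a2 b1 b2 => [|n IHn] a1 a2 b1 b2 le_n mod_k.
  case: a1 a2 b1 b2 le_n {mod_k} => [|?] [|?] [|?] [|?] //= _; by rewrite subrr.
have modS x y : (x.+1 = y.+1 %[mod k] -> x = y %[mod k])%N.
  by move=> /eqP; rewrite -(addn1 x) -(addn1 y) eqn_modDr => /eqP.
case: (posnP a1) => [a10|]; last case: (posnP b1) => [b10 a1p|].
- subst a1; case: (posnP a2) => [a20|a2p].
    subst a2; move: mod_k; rewrite mod0n => /esym/eqP kd.
    have := ideal_opp iI (vfree _ _ _ (leqnn _) kd).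
    by rewrite /mono4 !expr0 !mul1r !mulr1 opprB.
  case: (posnP b1) => [b10|b1p].
    subst b1; case: (posnP b2) => [b20|b2p].
      subst b2; move: mod_k; rewrite mod0n => /eqP kd.
      have := vfree _ _ _ (leqnn _) kd.
      by rewrite /mono4 !expr0 !mul1r !mulr1.
    case: a2 b2 a2p b2p le_n mod_k => [|a2] [|b2] // _ _ le_n mod_k.
    rewrite step2; apply/IM/IHn; first lia.
    by apply: modS; move: mod_k; rewrite !addnS.
  case: a2 a2p le_n mod_k => [|a2] // _ le_n mod_k.
  case: b2 le_n mod_k => [|b2] le_n mod_k; last first.
    rewrite step2; apply/IM/IHn; first lia.
    by apply: modS; move: mod_k; rewrite !addnS.
  case: b1 b1p le_n mod_k => [|b1] // _ le_n mod_k.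
  rewrite step3; apply: IA; last by apply: IM.
  apply/IM/IHn; first lia.
  by apply: modS; move: mod_k; rewrite addn0 add0n addn0.
- subst b1; case: (posnP b2) => [b20|b2p].
    subst b2; move: mod_k; rewrite mod0n => /eqP kd.
    have := vfree _ _ _ (leqnn _) kd.
    by rewrite /mono4 !expr0 !mul1r !mulr1.
  case: b2 b2p le_n mod_k => [|b2] // _ le_n mod_k.
  case: a2 le_n mod_k => [|a2] le_n mod_k; last first.
    rewrite step2; apply/IM/IHn; first lia.
    by apply: modS; move: mod_k; rewrite !addnS.
  case: a1 a1p le_n mod_k => [|a1] // _ le_n mod_k.
  rewrite step4; apply: IA; last by apply: IM.
  apply/IM/IHn; first lia.
  by apply: modS; move: mod_k; rewrite addn0 add0n addn0.
- case: b1 le_n mod_k => [|b1] // le_n mod_k _.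
  case: a1 le_n mod_k => [|a1] // le_n mod_k _.
  rewrite step1; apply/IM/IHn; first lia.
  by apply: modS; move: mod_k; rewrite !addSn.
Qed.

Definition gideal (k : nat) : set P :=
  igen [set x | x = Dgen \/ exists2 a, (a <= k)%N & x = Egen k a].

Lemma gideal_D k : gideal k Dgen.
Proof. by apply: igen_mem; left. Qed.

Lemma gideal_E k a : (a <= k)%N -> gideal k (Egen k a).
Proof. by move=> ak; apply: igen_mem; right; exists a. Qed.

(** The difference is [Dgen] times a swap difference whose two halves both have degree [k - 1].
    Equal degrees allow [mono4_swap] with modulus 0, so this cofactor is again a multiple of [Dgen],
    hence lies in [gideal k]. *)
Lemma Egen_exchange1 k a b : (a < k)%N -> (b < k)%N ->
  exists2 h, gideal k h &
    Egen k a * Egen k b.+1 - Egen k a.+1 * Egen k b = Dgen * h.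
Proof.
move=> ak bk; have iA := igen_ideal [set x | x = Dgen \/ exists2 a, (a <= k)%N & x = Egen k a].
exists (mono4 a (k - a.+1) b (k - b.+1) - mono4 b (k - b.+1) a (k - a.+1)).
  have [|||y ->] := @mono4_swap 0 _ a (k - a.+1) b (k - b.+1) (principal_ideal Dgen).
  - by exists 1; rewrite mulr1.
  - move=> [|//] _; exists 0; rewrite /Egen !expr0; ring.
  - by rewrite !modn0; lia.
  by case: iA => _ _ IM; rewrite mulrC; apply/IM/gideal_D.
rewrite /mono4 /Egen /Dgen.
have -> : (k - a = (k - a.+1).+1)%N by lia.
have -> : (k - b = (k - b.+1).+1)%N by lia.
rewrite !exprS.
move: (U1 ^+ _) (U1 ^+ _) (U2 ^+ _) (U2 ^+ _) (V1 ^+ _) (V1 ^+ _) (V2 ^+ _) (V2 ^+ _) => *.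
ring.
Qed.

(** Congruence modulo [Dgen * I]. With [I] as a parameter, the error between products of [j + 1]
    factors can be recorded in [Dgen] times the [j]-th power of the ideal. *)
Definition eqD (I : set P) x y : Prop := exists2 h, I h & x - y = Dgen * h.

Section EqD.
Variables (I : set P) (iI : is_ideal I).

Lemma eqD_refl x : eqD I x x.
Proof. by case: iI => I0 _ _; exists 0 => //; rewrite subrr mulr0. Qed.

Lemma eqD_sym x y : eqD I x y -> eqD I y x.
Proof.
by case=> h Ih xy; exists (- h); [exact: ideal_opp | rewrite -opprB xy mulrN].
Qed.

Lemma eqD_trans y x z : eqD I x y -> eqD I y z -> eqD I x z.
Proof.
case: iI => _ IA _ [h Ih xy] [g Ig yz]; exists (h + g); first exact: IA.
by rewrite mulrDr -xy -yz addrA subrK.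
Qed.

End EqD.

Lemma eqD_mul (I J K : set P) x y z : (forall f g, I f -> J g -> K (f * g)) ->
  eqD I x y -> J z -> eqD K (x * z) (y * z).
Proof.
by move=> IJK [h Ih xy] Jz; exists (h * z); [exact: IJK | rewrite -mulrBl xy mulrA].
Qed.

Lemma Egen_exchange k a b c d : (a <= k)%N -> (b <= k)%N -> (c <= k)%N -> (d <= k)%N ->
  (a + b = c + d)%N -> eqD (gideal k) (Egen k a * Egen k b) (Egen k c * Egen k d).
Proof.
have iA : is_ideal (gideal k) by apply: igen_ideal.
wlog ac : a b c d / (a <= c)%N => [hw ak bk ck dk e|].
  case: (leqP a c) => [ac|/ltnW ca]; first exact: hw.
  by apply: eqD_sym => //; apply: hw.
move=> ak bk ck dk; rewrite -(subnKC ac) in ck *.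
move: (c - a)%N ck {ac} => n; elim: n a b d ak bk dk => [|n IHn] a b d ak bk dk ck e.
  by have -> : d = b; [lia | rewrite addn0; apply: eqD_refl].
case: b bk e => [|b] bk e; first by lia.
have [||h Ih Eh] := @Egen_exchange1 k a b; [lia | lia |].
apply: (@eqD_trans _ iA (Egen k a.+1 * Egen k b)); first by exists h.
by rewrite addnS -addSn; apply: IHn; lia.
Qed.

(** Absorbs one more factor into the canonical product. If [a + c < k], the leading factors are
    exchanged for [Egen k (a + c)] and [Egen k 0]. Otherwise they become [Egen k k], the head that
    [Fgen] prescribes, and [Egen k e], which the induction hypothesis moves into the tail. *)
Lemma Egen_Fgen k a j c : (a <= k)%N -> (c <= j * k)%N ->
  eqD (ipow (gideal k) j) (Egen k a * Fgen k j c) (Fgen k j.+1 (a + c)).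
Proof.
elim: j a c => [|j IHj] a c ak cj.
  have -> : c = 0%N by lia.
  rewrite /= addn0 !mulr1 (minn_idPr ak).
  exact: (eqD_refl (ipow_ideal (gideal k) 0)).
set I := ipow (gideal k) j.+1; have iI : is_ideal I by apply: ipow_ideal.
have iA : is_ideal (gideal k) by apply: igen_ideal.
have FI i d : (d <= i * k)%N -> ipow (gideal k) i (Fgen k i d).
  elim: i d => [|i IHi] d di //=.
  by apply: imul_mem; [apply: gideal_E; apply: geq_minl | apply: IHi; lia].
have AI f g : gideal k f -> ipow (gideal k) j g -> I (f * g) by apply: imul_mem.
have [kc|ck] := leqP k (a + c); last first.
  have c0 : (c - k = 0)%N by lia.
  have ac0 : (a + c - k = 0)%N by lia.
  have ck' : (c <= k)%N by lia.
  rewrite /= (minn_idPr ck') (minn_idPr (ltnW ck)) c0 ac0 !mulrA.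
  have -> : (minn k 0 = 0)%N by lia.
  have F0 := FI j 0%N isT.
  apply: (eqD_mul AI _ F0); apply: Egen_exchange => //; lia.
have [b bE] : exists b, b = minn k c by exists (minn k c).
have [e eE] : exists e, e = (a + b - k)%N by exists (a + b - k)%N.
have -> : Fgen k j.+1 c = Egen k b * Fgen k j (c - k) by rewrite bE.
have -> : Fgen k j.+2 (a + c) = Egen k k * Fgen k j.+1 (a + c - k).
  by rewrite [LHS]/= (minn_idPl kc).
apply: (@eqD_trans _ iI (Egen k k * (Egen k e * Fgen k j (c - k)))).
  rewrite !mulrA; apply: (eqD_mul AI); last by apply: FI; lia.
  by apply: Egen_exchange; lia.
have -> : (a + c - k = e + (c - k))%N by lia.
have AI' f g : ipow (gideal k) j f -> gideal k g -> I (f * g).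
  by move=> If Ig; rewrite mulrC; apply: AI.
rewrite ![Egen k k * _]mulrC; apply: (eqD_mul AI'); last exact: gideal_E.
by apply: IHj; lia.
Qed.

Definition Gset (k m : nat) : set P :=
  [set x | exists j c, [/\ (j <= m)%N, (c <= j * k)%N & x = Ggen k m j c]].

(** The induction must be strong: a generator times [Egen k e] is a generator plus an error in
    [Dgen ^+ (m.+1 - j)] times the [j]-th power, and [shift] treats that error by the statement for
    the exponent [j]. *)
Lemma ipow_gideal k m : ipow (gideal k) m = igen (Gset k m).
Proof.
have iA : is_ideal (gideal k) by apply: igen_ideal.
have FI i d : (d <= i * k)%N -> ipow (gideal k) i (Fgen k i d).
  elim: i d => [|i IHi] d di //=.
  by apply: imul_mem; [apply: gideal_E; apply: geq_minl | apply: IHi; lia].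
apply/seteqP; split=> x; last first.
  apply: igen_min; first exact: ipow_ideal.
  move=> {}x [j [c [jm cj ->]]].
  rewrite /Ggen; move: (m - j)%N (subnK jm) => d <-.
  elim: d => [|d IHd]; first by rewrite expr0 mul1r; apply: FI.
  by rewrite exprS -mulrA addSn; apply: imul_mem => //; apply: gideal_D.
elim: {m}m.+1 {-2}m (ltnSn m) x => [//|n IHn] [|m] mn x.
  move=> _; rewrite -[x]mulr1; have [_ _ IM] := igen_ideal (Gset k 0).
  by apply/IM/igen_mem; exists 0%N, 0%N; split=> //; rewrite /Ggen expr0 mul1r.
have iG : is_ideal (igen (Gset k m.+1)) by apply: igen_ideal.
have [_ GA GM] := iG.
have shift i h : (i <= m)%N -> ipow (gideal k) i h -> igen (Gset k m.+1) (Dgen ^+ (m.+1 - i) * h).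
  move=> im /IHn Ih; have {Ih}: igen (Gset k i) h by apply: Ih; lia.
  case=> p [r [f [Sf ->]]]; rewrite mulr_sumr; apply: ideal_sum => // a _.
  have [j [c [ji cj ->]]] := Sf a; rewrite mulrCA; apply/GM/igen_mem.
  exists j, c; split=> //; first by lia.
  rewrite /Ggen mulrA -exprD; congr (_ ^+ _ * _); lia.
apply: imul_min => // {}x y Ax Iy.
have {Iy}: igen (Gset k m) y by apply: IHn => //; lia.
case=> p [r [f [Sf ->]]]; rewrite mulr_sumr; apply: ideal_sum => // a _.
have [j [c [jm cj ->]]] := Sf a; rewrite mulrCA; apply/GM.
rewrite mulrC; case: Ax => q [s [g [Sg ->]]]; rewrite mulr_sumr.
apply: ideal_sum => // b _; rewrite mulrCA; apply/GM.
have [->|[e ek ->]] := Sg b.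
  apply: igen_mem; exists j, c; split=> //; first by lia.
  by rewrite /Ggen mulrC mulrA -exprS -subSn.
have [h Ih] := Egen_Fgen ek cj.
move/eqP; rewrite subr_eq => /eqP Eh.
have -> : Ggen k m j c * Egen k e =
    Dgen ^+ (m.+1 - j) * h + Dgen ^+ (m.+1 - j.+1) * Fgen k j.+1 (e + c).
  by rewrite /Ggen -mulrA [_ * Egen k e]mulrC Eh subSS mulrDr addrC addrC subSn // exprSr mulrA.
apply/GA; first exact: shift.
by apply: igen_mem; exists j.+1, (e + c)%N; split=> //; lia.
Qed.

End Generators.

(** * Minimality of the generators *)

Section Independence.
Variables (P : comNzRingType) (F : fieldType) (U1 U2 V1 V2 : P).
Variables (phi : {rmorphism P -> {poly {poly F}}}) (cst : F -> P) (k m : nat).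
Hypothesis k2 : (2 <= k)%N.
Hypothesis phi_cst : forall a, phi (cst a) = a%:P%:P.
Hypotheses (phiU1 : phi U1 = 'X) (phiU2 : phi U2 = 'X)
  (phiV1 : phi V1 = 0) (phiV2 : phi V2 = 'X * ('X)%:P).

Local Notation G := (Ggen U1 U2 V1 V2 k m).
Definition Gdeg (j : nat) : nat := (2 * (m - j) + j * k)%N.

(** The outer variable is [t], the inner one [s]. [Dgen] goes to [s t^2]; [Egen k a] goes to [t^k]
    for [0 < a], and [Egen k 0] to [(1 - s^k) t^k]. *)
Lemma phi_Ggen j c : exists2 e : {poly F}, e`_0 = 1 &
  phi (G j c) = ('X^(m - j) * e)%:P * 'X^(Gdeg j).
Proof.
have phiE a : exists2 e : {poly F}, e`_0 = 1 & phi (Egen U1 U2 V1 V2 k (minn k a)) = e%:P * 'X^k.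
  set b := minn k a; have bk : (b <= k)%N by apply: geq_minl.
  rewrite /Egen rmorphB !rmorphM !rmorphXn /= phiU1 phiU2 phiV1 phiV2.
  rewrite -exprD subnKC //; case: b bk => [|b] bk.
    exists (1 - 'X^k).
      by rewrite coefB coef1 coefXn; case: k k2 => //= ? _; rewrite subr0.
    by rewrite expr0 mul1r subn0 exprMn polyCB rmorphXn /= mulrBl mul1r mulrC.
  by exists 1; rewrite ?coef1 // exprS !mul0r subr0 mul1r.
have phiF i d : exists2 e : {poly F}, e`_0 = 1 & phi (Fgen U1 U2 V1 V2 k i d) = e%:P * 'X^(i * k).
  elim: i d => [|i IHi] d /=.
    by exists 1; rewrite ?coef1 // rmorph1 mul0n expr0 mulr1.
  have [e1 e10 h1] := phiE d; have [e2 e20 h2] := IHi (d - k)%N.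
  exists (e1 * e2); first by rewrite coef0M e10 e20 mulr1.
  by rewrite rmorphM /= h1 h2 mulSn exprD polyCM; ring.
have [e e0 hF] := phiF j c; exists e => //.
rewrite /Ggen rmorphM rmorphXn /= hF /Dgen rmorphB !rmorphM /= phiU1 phiU2 phiV1 phiV2.
have -> : 'X * ('X * 'X%:P) - 0 * 'X = 'X%:P * 'X^2 :> {poly {poly F}} by ring.
by rewrite exprMn -exprM /Gdeg exprD rmorphXn /= mulrACA.
Qed.

(** Compares the coefficients of [t^d s^(m - j0)], where [j0] is the largest index with [a j0 != 0].
    On the left, smaller [j] carry higher powers of [s]. On the right, a generator of degree [d] has
    a coefficient without constant term, one of larger degree contributes nothing, and one of
    smaller degree has index below [j0], because [Gdeg] is nondecreasing in [j] for [2 <= k]; its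
    power of [s] is then too high. *)
Lemma Ggen_indep (d n : nat) (a : nat -> F) (g : nat -> nat)
    (r : 'I_n -> P) (jj cc : 'I_n -> nat) :
  (forall j, a j != 0 -> Gdeg j = d) ->
  (forall l, (jj l <= m)%N) -> (forall l, (phi (r l))`_0 = 0) ->
  \sum_(j < m.+1) cst (a j) * G j (g j) = \sum_(l < n) r l * G (jj l) (cc l) ->
  forall j, (j <= m)%N -> a j = 0.
Proof.
move=> ad jjm r0 eqG.
have [|/forallPn /= ex] := boolP [forall j : 'I_m.+1, a j == 0].
  by move=> /forallP a0 j jm; have := a0 (Ordinal (jm : (j < m.+1)%N)) => /eqP.
case: ex => i0 ai0.
pose j0 := [arg max_(i > i0 | (a i != 0)%R) (i : nat)]%N.
have [aj0 j0max] : a j0 != 0 /\ forall j : 'I_m.+1, a j != 0 -> (j <= j0)%N.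
  by rewrite /j0; case: arg_maxnP.
exfalso; move/eqP: (aj0); apply.
have /(congr1 (fun p : {poly {poly F}} => (p`_d)`_(m - j0))) := congr1 phi eqG.
rewrite !rmorph_sum !coef_sum /= (bigD1 j0) //=.
rewrite [X in _ + X = _]big1 ?addr0; last first.
  move=> j jj0; have [->|aj] := eqVneq (a j) 0.
    by rewrite rmorphM /= phi_cst !polyC0 mul0r !coef0.
  have [e e0 h] := phi_Ggen j (g j); rewrite rmorphM /= h phi_cst mulrA -polyCM.
  rewrite coefCM coefXn (ad _ aj) eqxx mulr1 coefCM coefXnM.
  have /(_ aj) := j0max j; rewrite leq_eqVlt => /orP[/eqP/val_inj jE|lt_j].
    by rewrite jE eqxx in jj0.
  by rewrite (_ : (_ < _)%N) ?mulr0 //; have := ltn_ord j0; lia.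
have [e e0 h] := phi_Ggen j0 (g j0); rewrite rmorphM /= h phi_cst mulrA -polyCM.
rewrite coefCM coefXn (ad _ aj0) eqxx mulr1 coefCM coefXnM ltnn subnn e0 mulr1 => ->.
apply: big1 => l _; have [e' _ h'] := phi_Ggen (jj l) (cc l).
rewrite rmorphM /= h' mulrA coefMXn; case: ltnP => [_|le_d]; first by rewrite coef0.
rewrite coefMC; have [dE|dE] := eqVneq d (Gdeg (jj l)).
  by rewrite dE subnn r0 mul0r coef0.
have ltj : (jj l < j0)%N.
  rewrite ltnNge; apply/negP => le_j; move: le_d dE; rewrite -(ad _ aj0) /Gdeg.
  have := jjm l; have := ltn_ord j0.
  have : (j0 * (k - 2) <= jj l * (k - 2))%N by rewrite leq_mul2r le_j orbT.
  by rewrite !mulnBr; have : (jj l * 2 <= jj l * k)%N by [rewrite leq_mul2l k2 orbT]; lia.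
rewrite mulrCA coefXnM (_ : (_ < _)%N) //.
by have := jjm l; have := ltn_ord j0; lia.
Qed.

End Independence.

(** * Alternating polynomials lie in the ideal of [Dgen] and [Egen] *)

Section Alternating.
Variables (F : fieldType) (P : comAlgType F) (U1 U2 V1 V2 : P).
Variables (s0 s1 : {lrmorphism P -> P}) (z zi : F) (k : nat).
Hypotheses (prim_z : k.-primitive_root z) (zzi : z * zi = 1).
Hypotheses (s0U1 : s0 U1 = V1) (s0U2 : s0 U2 = V2) (s0V1 : s0 V1 = U1) (s0V2 : s0 V2 = U2).
Hypotheses (s1U1 : s1 U1 = z *: V1) (s1U2 : s1 U2 = z *: V2)
  (s1V1 : s1 V1 = zi *: U1) (s1V2 : s1 V2 = zi *: U2).

Lemma s0_Dgen : s0 (Dgen U1 U2 V1 V2) = - Dgen U1 U2 V1 V2.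
Proof.
by rewrite /Dgen rmorphB !rmorphM /= s0U1 s0U2 s0V1 s0V2 opprB.
Qed.

Lemma s1_Dgen : s1 (Dgen U1 U2 V1 V2) = - Dgen U1 U2 V1 V2.
Proof.
rewrite /Dgen rmorphB !rmorphM /= s1U1 s1U2 s1V1 s1V2 opprB.
by rewrite -!scalerAl -!scalerAr !scalerA zzi [zi * z]mulrC zzi !scale1r.
Qed.

Lemma s0_Egen a : s0 (Egen U1 U2 V1 V2 k a) = - Egen U1 U2 V1 V2 k a.
Proof.
by rewrite /Egen rmorphB !rmorphM !rmorphXn /= s0U1 s0U2 s0V1 s0V2 opprB.
Qed.

Lemma s1_Egen a : (a <= k)%N -> s1 (Egen U1 U2 V1 V2 k a) = - Egen U1 U2 V1 V2 k a.
Proof.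
move=> ak; have zk : z ^+ k = 1 by apply: prim_expr_order.
have zik : zi ^+ k = 1 by rewrite -[LHS]mul1r -{1}zk -exprMn zzi expr1n.
rewrite /Egen rmorphB !rmorphM !rmorphXn /= s1U1 s1U2 s1V1 s1V2 opprB.
rewrite !exprZn -!scalerAl -!scalerAr !scalerA -!exprD subnKC // zk zik !scale1r.
by [].
Qed.

Local Notation mono := (mono4 U1 U2 V1 V2).

Lemma s0_mono a1 a2 b1 b2 : s0 (mono a1 a2 b1 b2) = mono b1 b2 a1 a2.
Proof.
rewrite /mono4 !rmorphM !rmorphXn /= s0U1 s0U2 s0V1 s0V2.
by rewrite mulrC mulrA mulrAC -!mulrA mulrCA; congr (_ * _); rewrite !mulrA mulrC !mulrA.
Qed.

Lemma s1_mono a1 a2 b1 b2 :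
  s1 (mono a1 a2 b1 b2) = (z ^+ (a1 + a2) * zi ^+ (b1 + b2)) *: mono b1 b2 a1 a2.
Proof.
rewrite /mono4 !rmorphM !rmorphXn /= s1U1 s1U2 s1V1 s1V2 !exprZn.
rewrite -!scalerAl -!scalerAr -!scalerAl !scalerA; congr (_ *: _).
  by rewrite !exprD; ring.
by ring.
Qed.

(** The composite of [s0] and [s1] fixes [p] and multiplies the [l]-th monomial by a [k]-th root of
    unity [w l]. Averaging over its [k] powers removes the monomials with [w l != 1] from the given
    expansion. The others satisfy the congruence of [mono4_swap], and [p + p = p - s0 p] is a
    combination of their swap differences. *)
Lemma alternating_gideal (n : nat) (c : 'I_n -> F) (e : 'I_n -> nat * nat * nat * nat) (p : P) :
  k%:R != 0 :> F -> 2%:R != 0 :> F ->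
  p = \sum_(l < n) c l *: mono (e l).1.1.1 (e l).1.1.2 (e l).1.2 (e l).2 ->
  s0 p = - p -> s1 p = - p -> gideal U1 U2 V1 V2 k p.
Proof.
move=> k0 two0 pE s0p s1p.
pose M l := mono (e l).1.1.1 (e l).1.1.2 (e l).1.2 (e l).2.
pose M' l := mono (e l).1.2 (e l).2 (e l).1.1.1 (e l).1.1.2.
pose w l := z ^+ ((e l).1.2 + (e l).2) * zi ^+ ((e l).1.1.1 + (e l).1.1.2).
have zk : z ^+ k = 1 by apply: prim_expr_order.
have zik : zi ^+ k = 1 by rewrite -[LHS]mul1r -{1}zk -exprMn zzi expr1n.
have wk l : w l ^+ k = 1 by rewrite exprMn -!exprM ![(_ * k)%N]mulnC !exprM zk zik !expr1n mulr1.
have gp i : p = \sum_(l < n) (c l * w l ^+ i) *: M l.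
  elim: i => [|i IHi]; first by rewrite [LHS]pE; apply: eq_bigr => l _; rewrite mulr1.
  have -> : p = s1 (s0 p) by rewrite s0p rmorphN /= s1p opprK.
  rewrite [in LHS]IHi raddf_sum /= raddf_sum /=; apply: eq_bigr => l _.
  by rewrite linearZ /= linearZ /= /M s0_mono s1_mono scalerA -mulrA -exprSr.
have pE' : p = \sum_(l < n | w l == 1) c l *: M l.
  apply: (scalerI k0); rewrite -[LHS]/(k%:R *: p).
  have -> : k%:R *: p = \sum_(i < k) p by rewrite sumr_const card_ord scaler_nat.
  rewrite (eq_bigr (fun i : 'I_k => \sum_(l < n) (c l * w l ^+ i) *: M l)) => [|i _]; last exact: gp.
  rewrite exchange_big /= [RHS]scaler_sumr [RHS]big_mkcond; apply: eq_bigr => l _.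
  rewrite -scaler_suml -mulr_sumr; case: eqVneq => [->|w1].
    rewrite (eq_bigr (fun=> 1)) => [|i _]; last by rewrite expr1n.
    by rewrite sumr_const card_ord scalerA mulrC.
  suff -> : \sum_(i < k) w l ^+ i = 0 by rewrite mulr0 scale0r.
  have /eqP := subrX1 (w l) k; rewrite wk subrr eq_sym mulf_eq0 subr_eq0 (negPf w1).
  by move/eqP.
have iA := igen_ideal [set x | x = Dgen U1 U2 V1 V2 \/
   exists2 a, (a <= k)%N & x = Egen U1 U2 V1 V2 k a].
have I2p : gideal U1 U2 V1 V2 k (p + p).
  have -> : p + p = p - s0 p by rewrite s0p opprK.
  rewrite [in X in X - _]pE' [in X in _ - X]pE' raddf_sum /= -sumrB.
  apply: ideal_sum => // l /eqP w1.
  rewrite linearZ /= -scalerBr -mulr_algl s0_mono; case: (iA) => _ _; apply.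
  apply: mono4_swap => //.
  - exact: gideal_D.
  - by move=> a; apply: gideal_E.
  apply/eqP; rewrite -(eq_prim_root_expr prim_z).
  have := congr1 (fun x => x * z ^+ ((e l).1.1.1 + (e l).1.1.2)) w1.
  by rewrite /w mul1r -mulrA -exprMn [zi * z]mulrC zzi expr1n mulr1 => ->.
have -> : p = (2%:R^-1)%:A * (p + p).
  by rewrite mulr_algl -mulr2n -scaler_nat scalerA mulVf // scale1r.
by case: iA => _ _; apply.
Qed.

End Alternating.

(** * Eigenforms of the Coxeter element *)

Section PrimitiveRoot.
Variable F : closedFieldType.

Lemma quadratic_root (s : F) : exists z : F, z ^+ 2 = s * z - 1.
Proof.
have [//|z zE] := @GRing.solve_monicpoly F 2 (fun i => if i == 0%N then -1 else s).
by exists z; rewrite zE !big_ord_recl big_ord0 /= expr0 expr1 mulr1 addr0 addrC.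
Qed.

Lemma primitive_rootP (k : nat) (z : F) : (0 < k)%N -> z ^+ k = 1 ->
  (forall m, (m %| k)%N -> (m < k)%N -> z ^+ m != 1) -> k.-primitive_root z.
Proof.
move=> k0 zk zm; have [m pm mk] := prim_order_exists k0 zk.
have := zm _ mk; rewrite (prim_expr_order pm) eqxx.
by case: ltnP (dvdn_leq k0 mk) => [_ _ /(_ isT)//|km mk' _]; have <- : m = k by lia.
Qed.

(* With [A, B] the negated off-diagonal Cartan entries, the last two equations say
   that [x0 + b x1] is sent to [z (- x0 + (A + b) x1)] by the second reflection. *)
Lemma eigenform_exists (k : nat) (A B : F) : (forall n : nat, n.+1%:R != 0 :> F) ->
  [\/ [/\ k = 2%N, A = 0 & B = 0], [/\ k = 3%N, A = 1 & B = 1],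
      [/\ k = 4%N, A = 2%:R & B = 1] | [/\ k = 6%N, A = 3%:R & B = 1]] ->
  exists z zi b : F, [/\ k.-primitive_root z, z * zi = 1, A + 2%:R * b != 0,
    1 + b * B = - z & - b = z * (A + b)].
Proof.
move=> char0 kAB.
have two0 := char0 1%N; have three0 := char0 2%N.
have zz (s z : F) : z ^+ 2 = s * z - 1 -> z * (s - z) = 1.
  by move=> zE; rewrite mulrBr -expr2 zE opprB addrC mulrC subrK.
(* For [B = 1] the two equations amount to [b = - (1 + z)] and [z ^+ 2 = s * z - 1]. Here [s] is the
   trace [2 cos(2 pi / k)] of the Coxeter element, and [s ^+ 2 != 4] makes its eigenvalues distinct,
   whence [A + 2 b != 0]. *)
have key s : s = A - 2%:R -> B = 1 -> s ^+ 2 != 2%:R ^+ 2 ->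
    (forall z, z ^+ 2 = s * z - 1 -> k.-primitive_root z) ->
  exists z zi b : F, [/\ k.-primitive_root z, z * zi = 1, A + 2%:R * b != 0,
    1 + b * B = - z & - b = z * (A + b)].
  move=> sA -> s4 pr; have [z zE] := quadratic_root s.
  exists z, (s - z), (- (1 + z)); split; first exact: pr.
  - exact: zz.
  - apply: contraNneq s4 => A0.
    have sz : s = 2%:R * z.
      by apply/eqP; rewrite -subr_eq0 -A0 sA; apply/eqP; ring.
    have e : s * z = 2%:R * z ^+ 2 by rewrite sz; ring.
    have z1 : z ^+ 2 = 1.
      have -> : z ^+ 2 = 2%:R * z ^+ 2 - z ^+ 2 by ring.
      by rewrite [in X in _ - X]zE e; ring.
    by rewrite sz exprMn z1 mulr1.
  - by ring.
  - have -> : A = s + 2%:R by rewrite sA; ring.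
    have e : z * (s + 2%:R + - (1 + z)) = z + (s * z - z ^+ 2) by ring.
    by rewrite e zE; ring.
case: kAB => -[kE AE BE].
(* The Coxeter element of [A1 x A1] is [-1], so every form is an eigenform and [b] need only be
   nonzero. *)
- exists (-1), (-1), 1; rewrite AE BE kE; split; [|ring| |ring|ring].
    apply: primitive_rootP => //; first by ring.
    move=> [|[|m]] //; rewrite ?expr1 // => _ _; apply: contraNneq two0 => h.
    by rewrite mulr2n -[X in X + _]h; apply/eqP; ring.
  by rewrite add0r mulr1.
- apply: (key (-1)) => //; first by rewrite AE; ring.
    by apply: contraNneq three0 => h; have -> : 3%:R = 2%:R ^+ 2 - (-1) ^+ 2 :> F by [ring|]; rewrite h subrr.
  move=> z zE; have z3 : z ^+ 3 = 1.
    have -> : z ^+ 3 = z * z ^+ 2 by ring.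
    have -> : z * z ^+ 2 = - (z ^+ 2) - z by rewrite {1}zE; ring.
    by rewrite zE; ring.
  rewrite kE; apply: primitive_rootP => // -[|[|[|m]]] // _ _.
  rewrite expr1; apply: contraNneq three0 => z1; move: zE; rewrite z1 => h.
  have -> : 3%:R = 1 ^+ 2 - (-1 * 1 - 1) :> F by ring.
  by rewrite h subrr.
- apply: (key 0) => //; first by rewrite AE subrr.
    by rewrite expr0n /= eq_sym expf_eq0.
  move=> z zE; have z2 : z ^+ 2 = -1 by rewrite zE mul0r add0r.
  rewrite kE; apply: primitive_rootP => //; first by rewrite (exprM z 2 2) z2; ring.
  have z2n : z ^+ 2 != 1.
    by rewrite z2; apply: contraNneq two0 => h; rewrite mulr2n -[X in X + _]h; apply/eqP; ring.
  move=> [|[|[|[|m]]]] // _ _.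
  by apply: contraNneq z2n => h; rewrite expr1 in h; rewrite h expr1n.
- apply: (key 1) => //; first by rewrite AE; ring.
    by apply: contraNneq three0 => h; have -> : 3%:R = 2%:R ^+ 2 - 1 ^+ 2 :> F by [ring|]; rewrite h subrr.
  move=> z zE; have z3 : z ^+ 3 = -1.
    have -> : z ^+ 3 = z * z ^+ 2 by ring.
    have -> : z * z ^+ 2 = z ^+ 2 - z by rewrite {1}zE; ring.
    by rewrite zE; ring.
  have z2n : z ^+ 2 != 1.
    apply: contraNneq three0 => h; have z2 : z = 2%:R.
      by have -> : z = z ^+ 2 + 1 by [rewrite zE mul1r subrK|]; rewrite h; ring.
    have -> : 3%:R = z ^+ 2 - (1 * z - 1) :> F by rewrite z2; ring.
    by rewrite -zE subrr.
  rewrite kE; apply: primitive_rootP => //; first by rewrite (exprM z 3 2) z3; ring.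
  move=> [|[|[|[|[|[|m]]]]]] // _ _.
    by apply: contraNneq z2n => h; rewrite expr1 in h; rewrite h expr1n.
  by rewrite z3; apply: contraNneq two0 => h; rewrite mulr2n -[X in X + _]h; apply/eqP; ring.
Qed.

End PrimitiveRoot.

(** * Morphisms out of polynomial rings, and binary linear forms *)

Section MpolyMorphisms.
Variables (n : nat) (K : comNzRingType).

Lemma mpoly_rmorph_ext (S : comNzRingType) (f g : {rmorphism {mpoly K[n]} -> S}) :
  (forall c, f c%:MP = g c%:MP) -> (forall i, f 'X_i = g 'X_i) -> f =1 g.
Proof.
move=> fgC fgX p; rewrite (mpolyE p) !rmorph_sum; apply: eq_bigr => m _ /=.
rewrite -mul_mpolyC !rmorphM /= fgC; congr (_ * _).
by rewrite mpolyXE_id !rmorph_prod; apply: eq_bigr => i _ /=; rewrite !rmorphXn fgX.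
Qed.

Lemma mpoly_lrmorph_ext (P : comAlgType K) (f g : {lrmorphism {mpoly K[n]} -> P}) :
  (forall i, f 'X_i = g 'X_i) -> f =1 g.
Proof.
move=> fgX; apply: mpoly_rmorph_ext => // c.
by rewrite -[c%:MP]mulr1 mul_mpolyC /= !linearZ /= !rmorph1.
Qed.

End MpolyMorphisms.

Section LinearForms.
Variables (K : comNzRingType) (V : lmodType K).

Definition lin2 (x y : V) (a b : K) : V := a *: x + b *: y.

Lemma lin2Z x y c a b : c *: lin2 x y a b = lin2 x y (c * a) (c * b).
Proof. by rewrite /lin2 scalerDr !scalerA. Qed.

Lemma lin2D x y a b c d : lin2 x y a b + lin2 x y c d = lin2 x y (a + c) (b + d).
Proof. by rewrite /lin2 !scalerDl addrACA. Qed.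

Lemma lin2_lin2 x y a b c d e f :
  lin2 (lin2 x y a b) (lin2 x y c d) e f = lin2 x y (e * a + f * c) (e * b + f * d).
Proof. by rewrite {1}/lin2 !lin2Z lin2D. Qed.

Lemma lin2l x y : lin2 x y 1 0 = x.
Proof. by rewrite /lin2 scale1r scale0r addr0. Qed.

Lemma lin2r x y : lin2 x y 0 1 = y.
Proof. by rewrite /lin2 scale1r scale0r add0r. Qed.

End LinearForms.

Lemma linear_lin2 (K : comNzRingType) (V W : lmodType K) (f : {linear V -> W}) x y a b :
  f (lin2 x y a b) = lin2 (f x) (f y) a b.
Proof. by rewrite /lin2 linearD !linearZ. Qed.

Lemma det_mx2 (K : comNzRingType) (M : 'M[K]_2) : \det M = M 0 0 * M 1 1 - M 0 1 * M 1 0.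
Proof.
rewrite (expand_det_row _ 0) !big_ord_recl big_ord0 addr0 /cofactor !det_mx11 !mxE /=.
rewrite /= expr0 mul1r expr1 mulN1r mulrN.
by congr (_ * M _ _ - M _ _ * M _ _); apply: val_inj.
Qed.

(** * The diagonal action on linear forms *)

Section Wact.
Variable R : realType.
Local Notation C := R[i].
Local Notation Pol := (mpoly.mpoly 4 R[i]).

Definition wact_forms (M : 'M[int]_2) : 4.-tuple Pol :=
  [tuple (if (i < 2)%N
            then \sum_(j < 2) ((M (inord i) j)%:~R : C) *: pvar R j
            else \sum_(j < 2) ((M (inord (i - 2)) j)%:~R : C) *: pvar R (j + 2))
     | i < 4].

Definition wactm (M : 'M[int]_2) : {lrmorphism Pol -> Pol} := comp_mpoly (wact_forms M).

Lemma wactE M p : wact M p = wactm M p. Proof. by []. Qed.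

Lemma wactmX M (i : 'I_4) : wactm M 'X_i = tnth (wact_forms M) i.
Proof. by rewrite /= comp_mpolyXU -tnth_nth. Qed.

Lemma wactm_pvar M (i : 'I_2) :
  wactm M (pvar R i) = lin2 (pvar R 0) (pvar R 1) (M i 0)%:~R (M i 1)%:~R.
Proof.
rewrite wactmX tnth_mktuple inordK; last by rewrite (ltn_trans (ltn_ord i)).
rewrite ltn_ord inord_val !big_ord_recl big_ord0 addr0 /lin2.
congr (_ *: _ + _ *: _); congr ((M i _)%:~R); exact: val_inj.
Qed.

Lemma wactm_pvar2 M (i : 'I_2) :
  wactm M (pvar R (i + 2)) = lin2 (pvar R 2) (pvar R 3) (M i 0)%:~R (M i 1)%:~R.
Proof.
have i4 : (i + 2 < 4)%N by have := ltn_ord i; lia.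
rewrite wactmX tnth_mktuple inordK // ltnNge leq_addl /= addnK inord_val.
rewrite !big_ord_recl big_ord0 addr0 /lin2.
congr (_ *: _ + _ *: _); congr ((M i _)%:~R); exact: val_inj.
Qed.

Lemma pol_lrmorph_ext (P : comAlgType C) (f g : {lrmorphism Pol -> P}) :
  (forall i : 'I_2, f (pvar R i) = g (pvar R i) /\ f (pvar R (i + 2)) = g (pvar R (i + 2))) ->
  f =1 g.
Proof.
move=> h; apply: mpoly_lrmorph_ext => i.
have -> : 'X_i = pvar R i :> Pol by rewrite /pvar inord_val.
case: i => -[|[|[|[|//]]]] i4 /=.
- by have [] := h 0.
- by have [] := h 1.
- by have [] := h 0.
- by have [] := h 1.
Qed.

Lemma wactm_pvarE M :
  [/\ wactm M (pvar R 0) = lin2 (pvar R 0) (pvar R 1) (M 0 0)%:~R (M 0 1)%:~R,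
      wactm M (pvar R 1) = lin2 (pvar R 0) (pvar R 1) (M 1 0)%:~R (M 1 1)%:~R,
      wactm M (pvar R 2) = lin2 (pvar R 2) (pvar R 3) (M 0 0)%:~R (M 0 1)%:~R &
      wactm M (pvar R 3) = lin2 (pvar R 2) (pvar R 3) (M 1 0)%:~R (M 1 1)%:~R].
Proof.
by split; [apply: (wactm_pvar M 0) | apply: (wactm_pvar M 1)
  | apply: (wactm_pvar2 M 0) | apply: (wactm_pvar2 M 1)].
Qed.

Lemma wactmN M p : wactm M (- p) = - wactm M p.
Proof. exact: raddfN. Qed.

Lemma wactm_lin2 M x y a b : wactm M (lin2 x y a b) = lin2 (wactm M x) (wactm M y) a b.
Proof. exact: linear_lin2. Qed.

Lemma wactM M N p : wactm (M *m N) p = wactm N (wactm M p).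
Proof.
apply: (@pol_lrmorph_ext _ (wactm (M *m N)) (wactm N \o wactm M)).
have entry i j : (M *m N) i j = M i 0 * N 0 j + M i 1 * N 1 j.
  by rewrite mxE !big_ord_recl big_ord0 addr0; congr (_ + M i _ * N _ j); apply: val_inj.
move=> i; split; rewrite [RHS]/=.
  have [h0 h1 _ _] := wactm_pvarE N.
  rewrite !wactm_pvar wactm_lin2 h0 h1 lin2_lin2 !entry.
  by rewrite !intrD !intrM.
have [_ _ h2 h3] := wactm_pvarE N.
rewrite !wactm_pvar2 wactm_lin2 h2 h3 lin2_lin2 !entry.
by rewrite !intrD !intrM.
Qed.

Lemma wact1 p : wactm 1%:M p = p.
Proof.
apply: (@pol_lrmorph_ext _ (wactm 1%:M) idfun) => i.
case: i => -[|[|//]] i2.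
- have [h0 _ h2 _] := wactm_pvarE 1%:M.
  by split; [apply: etrans h0 _ | apply: etrans h2 _]; rewrite !mxE lin2l.
- have [_ h1 _ h3] := wactm_pvarE 1%:M.
  by split; [apply: etrans h1 _ | apply: etrans h3 _]; rewrite !mxE lin2r.
Qed.

Lemma simple_reflE k (i a b : 'I_2) :
  simple_refl k i a b = (a == b)%:R - (a == i)%:R * cartan k i b.
Proof.
rewrite !mxE; congr (_ - _); rewrite (bigD1 i) //= big1 ?addr0.
  by rewrite !mxE eqxx andbT.
by move=> j ji; rewrite !mxE (negPf ji) andbF mul0r.
Qed.

Lemma det_simple_refl k i : \det (simple_refl k i) = -1.
Proof.
rewrite det_mx2 !simple_reflE.
by case: i => -[|[|//]] i2; rewrite !mxE /=; lia.
Qed.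

Lemma alternating_gens k p :
  (forall i, wactm (simple_refl k i) p = - p) -> Defs.alternating k p.
Proof.
move=> hp _ [s ->]; rewrite wactE.
elim: s => [|i s IHs].
  by rewrite big_nil wact1 det1 scale1r.
rewrite big_cons -[_ * _]/(_ *m _) wactM hp.
by rewrite wactmN IHs det_mulmx det_simple_refl mulN1r rmorphN scaleNr.
Qed.

Lemma weyl_simple_refl k i : weyl k (simple_refl k i).
Proof. by exists [:: i]; rewrite big_seq1. Qed.

Lemma alternating_simple k i p : Defs.alternating k p -> wactm (simple_refl k i) p = - p.
Proof.
by move/(_ _ (weyl_simple_refl k i)); rewrite wactE det_simple_refl rmorphN1 scaleN1r.
Qed.

Section Eigenforms.
Variables (k : nat) (z zi b : C).
Let A : C := - (cartan k 0 1)%:~R.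
Let B : C := - (cartan k 1 0)%:~R.
Hypotheses (prim_z : k.-primitive_root z) (zzi : z * zi = 1).
Hypotheses (d0 : A + 2%:R * b != 0) (bB : 1 + b * B = - z) (bA : - b = z * (A + b)).

(** An eigenform of the Coxeter element, normalised to leading coefficient 1. The forms [V] below
    are the images of the forms [U] under the first reflection. *)
Definition formU1 : Pol := lin2 (pvar R 0) (pvar R 1) 1 b.
Definition formU2 : Pol := lin2 (pvar R 2) (pvar R 3) 1 b.
Definition formV1 : Pol := lin2 (pvar R 0) (pvar R 1) (-1) (A + b).
Definition formV2 : Pol := lin2 (pvar R 2) (pvar R 3) (-1) (A + b).

Let s0 := wactm (simple_refl k 0).
Let s1 := wactm (simple_refl k 1).

Let entries : [/\ (simple_refl k 0 0 0)%:~R = -1 :> C,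
  (simple_refl k 0 0 1)%:~R = A, (simple_refl k 0 1 0)%:~R = 0 :> C &
  (simple_refl k 0 1 1)%:~R = 1 :> C].
Proof.
split; rewrite simple_reflE /=.
- by rewrite mxE.
- by rewrite mul1r sub0r rmorphN.
- by rewrite mul0r subr0.
- by rewrite mul0r subr0.
Qed.

Let entries1 : [/\ (simple_refl k 1 0 0)%:~R = 1 :> C,
  (simple_refl k 1 0 1)%:~R = 0 :> C, (simple_refl k 1 1 0)%:~R = B &
  (simple_refl k 1 1 1)%:~R = -1 :> C].
Proof.
split; rewrite simple_reflE /=.
- by rewrite mul0r subr0.
- by rewrite mul0r subr0.
- by rewrite mul1r sub0r rmorphN.
- by rewrite mxE.
Qed.

Lemma s0_formU : s0 formU1 = formV1 /\ s0 formU2 = formV2.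
Proof.
have [e1 e2 e3 e4] := entries; have [h0 h1 h2 h3] := wactm_pvarE (simple_refl k 0).
split; rewrite /s0 wactm_lin2 ?h0 ?h1 ?h2 ?h3 lin2_lin2 e1 e2 e3 e4 /formV1 /formV2.
  by congr lin2; ring.
by congr lin2; ring.
Qed.

Lemma s0_formV : s0 formV1 = formU1 /\ s0 formV2 = formU2.
Proof.
have [e1 e2 e3 e4] := entries; have [h0 h1 h2 h3] := wactm_pvarE (simple_refl k 0).
split; rewrite /s0 wactm_lin2 ?h0 ?h1 ?h2 ?h3 lin2_lin2 e1 e2 e3 e4 /formU1 /formU2.
  by congr lin2; ring.
by congr lin2; ring.
Qed.

Lemma s1_formU : s1 formU1 = z *: formV1 /\ s1 formU2 = z *: formV2.
Proof.
have [e1 e2 e3 e4] := entries1; have [h0 h1 h2 h3] := wactm_pvarE (simple_refl k 1).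
have c1 : 1 * 1 + b * B = z * -1 by rewrite mulr1 bB mulrN1.
have c2 : 1 * 0 + b * -1 = z * (A + b) by rewrite -bA; ring.
by split; rewrite /s1 wactm_lin2 ?h0 ?h1 ?h2 ?h3 lin2_lin2 e1 e2 e3 e4
  /formV1 /formV2 lin2Z c1 c2.
Qed.

Lemma s1_formV : s1 formV1 = zi *: formU1 /\ s1 formV2 = zi *: formU2.
Proof.
have [e1 e2 e3 e4] := entries1; have [h0 h1 h2 h3] := wactm_pvarE (simple_refl k 1).
have Ab : A + b = - (zi * b).
  by rewrite -mulrN bA mulrA [zi * z]mulrC zzi mul1r.
have c1 : -1 * 1 + (A + b) * B = zi * 1.
  have -> : (A + b) * B = zi - zi * (1 + b * B) by rewrite Ab; ring.
  by rewrite bB; rewrite mulrN [zi * z]mulrC zzi; ring.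
have c2 : -1 * 0 + (A + b) * -1 = zi * b by rewrite Ab; ring.
by split; rewrite /s1 wactm_lin2 ?h0 ?h1 ?h2 ?h3 lin2_lin2 e1 e2 e3 e4
  /formU1 /formU2 lin2Z c1 c2.
Qed.

End Eigenforms.

End Wact.

(** The variables come in the order [x1, x2, y1, y2] and correspond to [U1, V1, U2, V2], whereas
    [mono4] lists both [U] first; hence the exchange of the middle indices. *)
Lemma prod4_mono4 (P : comNzRingType) (x0 x1 x2 x3 : P) (e : 'I_4 -> nat) :
  \prod_(i < 4) tnth [tuple x0; x1; x2; x3] i ^+ e i =
  mono4 x0 x2 x1 x3 (e (inord 0)) (e (inord 2)) (e (inord 1)) (e (inord 3)).
Proof.
rewrite !big_ord_recl big_ord0 mulr1 /mono4 !(tnth_nth 0) /=.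
have E i (j : 'I_4) : j = i :> nat -> j = inord i.
  by move=> ji; apply: val_inj; rewrite /= inordK // -ji.
rewrite -!mulrA [X in _ = _ * X]mulrCA.
by congr (_ ^+ e _ * (_ ^+ e _ * (_ ^+ e _ * _ ^+ e _))); apply: E.
Qed.

(** * The alternating ideal in the coordinates [U], [V] *)

Section AltIdeal.
Variable R : realType.
Local Notation C := R[i].
Local Notation Pol := (mpoly.mpoly 4 R[i]).
Local Notation S := {poly {poly C}}.

Definition subst4 (t : 4.-tuple Pol) : {lrmorphism Pol -> Pol} := comp_mpoly t.

Lemma subst4_pvar t (i : 'I_4) : subst4 t (pvar R i) = tnth t i.
Proof. by rewrite /= comp_mpolyXU -tnth_nth inord_val. Qed.

Lemma subst4_pvarE (x0 x1 x2 x3 : Pol) :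
  [/\ subst4 [tuple x0; x1; x2; x3] (pvar R 0) = x0,
      subst4 [tuple x0; x1; x2; x3] (pvar R 1) = x1,
      subst4 [tuple x0; x1; x2; x3] (pvar R 2) = x2 &
      subst4 [tuple x0; x1; x2; x3] (pvar R 3) = x3].
Proof.
have h i (i4 : (i < 4)%N) := subst4_pvar [tuple x0; x1; x2; x3] (Ordinal i4).
by split; [apply: etrans (h 0%N isT) _ | apply: etrans (h 1%N isT) _
  | apply: etrans (h 2%N isT) _ | apply: etrans (h 3%N isT) _]; rewrite (tnth_nth 0).
Qed.

Lemma subst4_lin2 t x y a b : subst4 t (lin2 x y a b) = lin2 (subst4 t x) (subst4 t y) a b.
Proof. exact: linear_lin2. Qed.

Lemma subst4_span t p : exists (n : nat) (c : 'I_n -> C) (e : 'I_n -> 'X_{1..4}),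
  subst4 t p = \sum_(l < n) c l *: \prod_(i < 4) tnth t i ^+ e l i.
Proof.
exists (size (msupp p)), (fun l => p@_(nth 0%MM (msupp p) l)), (fun l => nth 0%MM (msupp p) l).
rewrite [LHS]comp_mpolyEX (big_nth 0%MM) big_mkord.
by apply: eq_bigr => l _; rewrite comp_mpolyX.
Qed.

Lemma lrmorph_cancel (f g : {lrmorphism Pol -> Pol}) :
  (forall i : 'I_2, f (g (pvar R i)) = pvar R i /\ f (g (pvar R (i + 2))) = pvar R (i + 2)) ->
  forall p, f (g p) = p.
Proof. by move=> fg; apply: (@pol_lrmorph_ext _ _ (f \o g) idfun). Qed.

Definition eval4 (h : 4.-tuple S) : {rmorphism Pol -> S} :=
  mmap ((@polyC {poly C}) \o (@polyC C)) (tnth h).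

Lemma eval4C h c : eval4 h c%:MP = c%:P%:P.
Proof. exact: mmapC. Qed.

Lemma eval4X h (i : 'I_4) : eval4 h 'X_i = tnth h i.
Proof. by rewrite [LHS]mmapX mmap1U. Qed.

Lemma eval4_lin2 h x y a b :
  eval4 h (lin2 x y a b) = a%:P%:P * eval4 h x + b%:P%:P * eval4 h y.
Proof.
have eval4Z c q : eval4 h (c *: q) = c%:P%:P * eval4 h q by apply: mmapZ.
by rewrite -!eval4Z; apply: rmorphD.
Qed.

Lemma eval4_pvarE (x0 x1 x2 x3 : S) :
  [/\ eval4 [tuple x0; x1; x2; x3] (pvar R 0) = x0,
      eval4 [tuple x0; x1; x2; x3] (pvar R 1) = x1,
      eval4 [tuple x0; x1; x2; x3] (pvar R 2) = x2 &
      eval4 [tuple x0; x1; x2; x3] (pvar R 3) = x3].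
Proof.
have h i (i4 : (i < 4)%N) : eval4 [tuple x0; x1; x2; x3] (pvar R i) =
    tnth [tuple x0; x1; x2; x3] (Ordinal i4).
  by rewrite /pvar (_ : inord i = Ordinal i4) ?eval4X //; apply: val_inj; rewrite /= inordK.
by split; [apply: etrans (h 0%N isT) _ | apply: etrans (h 1%N isT) _
  | apply: etrans (h 2%N isT) _ | apply: etrans (h 3%N isT) _]; rewrite (tnth_nth 0).
Qed.

Lemma eval4_coef0 (h : 4.-tuple S) p : (forall i, (tnth h i)`_0 = 0) ->
  (eval4 h p)`_0 = (p@_0%MM)%:P.
Proof.
move=> h0.
apply: (@mpoly_rmorph_ext _ _ _ ((coefp 0) \o (eval4 h)) ((@polyC C) \o (mcoeff 0%MM))).
  by move=> c; rewrite [LHS]/= [RHS]/= eval4C coefC mcoeffC eqxx mulr1.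
move=> i; rewrite [LHS]/= [RHS]/= eval4X h0 mcoeffX.
by rewrite -mdeg_eq0 mdeg1.
Qed.

Lemma altideal_gideal (s0 s1 : {lrmorphism Pol -> Pol}) (U1 U2 V1 V2 : Pol) (k : nat) (z zi : C) :
  (forall p, Defs.alternating k p <-> s0 p = - p /\ s1 p = - p) ->
  k.-primitive_root z -> z * zi = 1 ->
  s0 U1 = V1 -> s0 U2 = V2 -> s0 V1 = U1 -> s0 V2 = U2 ->
  s1 U1 = z *: V1 -> s1 U2 = z *: V2 -> s1 V1 = zi *: U1 -> s1 V2 = zi *: U2 ->
  (forall p, exists (n : nat) (c : 'I_n -> C) (e : 'I_n -> nat * nat * nat * nat),
    p = \sum_(l < n) c l *: mono4 U1 U2 V1 V2 (e l).1.1.1 (e l).1.1.2 (e l).1.2 (e l).2) ->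
  altideal k = gideal U1 U2 V1 V2 k.
Proof.
move=> altP prim_z zzi u1 u2 v1 v2 u1' u2' v1' v2' span.
have kF : k%:R != 0 :> C by rewrite pnatr_eq0 -lt0n (prim_order_gt0 prim_z).
have F2 : 2%:R != 0 :> C by rewrite pnatr_eq0.
apply/seteqP; split=> q; apply: igen_sub => p.
  case/altP => a0 a1; have [n [c [e pE]]] := span p.
  exact: (alternating_gideal prim_z zzi u1 u2 v1 v2 u1' u2' v1' v2' kF F2 pE a0 a1).
case=> [->|[a ak ->]]; apply: igen_mem; apply/altP; split.
- exact: s0_Dgen u1 u2 v1 v2.
- exact: s1_Dgen zzi u1' u2' v1' v2'.
- exact: s0_Egen u1 u2 v1 v2 _.
- exact: s1_Egen prim_z zzi u1' u2' v1' v2' _ ak.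
Qed.

Section Forms.
Variables (k : nat) (z zi b : C).
Let A : C := - (cartan k 0 1)%:~R.
Let B : C := - (cartan k 1 0)%:~R.
Hypotheses (prim_z : k.-primitive_root z) (zzi : z * zi = 1).
Hypotheses (d0 : A + 2%:R * b != 0) (bB : 1 + b * B = - z) (bA : - b = z * (A + b)).
(** The determinant of the passage from the variables to the forms [U] and [V]. *)
Let d := A + 2%:R * b.

Let U1 := formU1 b.
Let U2 := formU2 b.
Let V1 := formV1 k b.
Let V2 := formV2 k b.

(** Cramer's rule with determinant [d] inverts the substitution [psi] of the forms for the
    variables. Thus [p = psi (rho p)], and expanding [rho p] into monomials expresses [p] in the
    forms. *)
Lemma forms_span p :
  exists (n : nat) (c : 'I_n -> C) (e : 'I_n -> nat * nat * nat * nat),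
  p = \sum_(l < n) c l *: mono4 U1 U2 V1 V2 (e l).1.1.1 (e l).1.1.2 (e l).1.2 (e l).2.
Proof.
pose psi := subst4 [tuple U1; V1; U2; V2].
pose X1 (x y : Pol) := lin2 x y (d^-1 * (A + b)) (- (d^-1 * b)).
pose X2 (x y : Pol) := lin2 x y d^-1 d^-1.
pose rho := subst4 [tuple X1 (pvar R 0) (pvar R 1); X2 (pvar R 0) (pvar R 1);
  X1 (pvar R 2) (pvar R 3); X2 (pvar R 2) (pvar R 3)].
have rhoK : psi (rho p) = p.
  apply: lrmorph_cancel.
  have psi_lin2 x y a c : psi (lin2 x y a c) = lin2 (psi x) (psi y) a c by apply: subst4_lin2.
  have [r0 r1 r2 r3] : [/\ rho (pvar R 0) = X1 (pvar R 0) (pvar R 1),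
      rho (pvar R 1) = X2 (pvar R 0) (pvar R 1), rho (pvar R 2) = X1 (pvar R 2) (pvar R 3) &
      rho (pvar R 3) = X2 (pvar R 2) (pvar R 3)] by apply: subst4_pvarE.
  have [p0 p1 p2 p3] : [/\ psi (pvar R 0) = U1, psi (pvar R 1) = V1, psi (pvar R 2) = U2 &
      psi (pvar R 3) = V2] by apply: subst4_pvarE.
  clearbody rho psi.
  have c1 : d^-1 * (A + b) * 1 + - (d^-1 * b) * -1 = 1.
    by rewrite -[RHS](mulVf d0) /d; ring.
  have c2 : d^-1 * (A + b) * b + - (d^-1 * b) * (A + b) = 0 by ring.
  have c3 : d^-1 * 1 + d^-1 * -1 = 0 by ring.
  have c4 : d^-1 * b + d^-1 * (A + b) = 1 by rewrite -[RHS](mulVf d0) /d; ring.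
  have e0 : psi (rho (pvar R 0)) = pvar R 0.
    by rewrite r0 psi_lin2 p0 p1 [lin2 U1 V1 _ _]lin2_lin2 c1 c2 lin2l.
  have e1 : psi (rho (pvar R 1)) = pvar R 1.
    by rewrite r1 psi_lin2 p0 p1 [lin2 U1 V1 _ _]lin2_lin2 c3 c4 lin2r.
  have e2 : psi (rho (pvar R 2)) = pvar R 2.
    by rewrite r2 psi_lin2 p2 p3 [lin2 U2 V2 _ _]lin2_lin2 c1 c2 lin2l.
  have e3 : psi (rho (pvar R 3)) = pvar R 3.
    by rewrite r3 psi_lin2 p2 p3 [lin2 U2 V2 _ _]lin2_lin2 c3 c4 lin2r.
  by case=> -[|[|//]] i2; split; [apply: e0 | apply: e2 | apply: e1 | apply: e3].
have [n [c [e pE]]] := subst4_span [tuple U1; V1; U2; V2] (rho p).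
exists n, c, (fun l => (e l (inord 0), e l (inord 2), e l (inord 1), e l (inord 3))).
rewrite -[LHS]rhoK [LHS]pE; apply: eq_bigr => l _; congr (_ *: _).
exact: prod4_mono4.
Qed.

Lemma altideal_forms : altideal k = gideal U1 U2 V1 V2 k.
Proof.
have [u1 u2] := s0_formU k b; have [v1 v2] := s0_formV k b.
have [u1' u2'] := s1_formU bB bA; have [v1' v2'] := s1_formV zzi bB bA.
apply: (altideal_gideal _ prim_z zzi u1 u2 v1 v2 u1' u2' v1' v2' forms_span) => p.
split; first by move=> altp; split; apply: alternating_simple.
case=> p0 p1; apply: alternating_gens => i.
have [->|->] : i = 0 \/ i = 1.
- by case: i => -[|[|//]] i2; [left | right]; apply: val_inj.
- exact: p0.
- exact: p1.
Qed.

Lemma forms_eval : exists phi : {rmorphism Pol -> S},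
  [/\ forall c, phi c%:MP = c%:P%:P, forall p, p@_0%MM = 0 -> (phi p)`_0 = 0,
      phi U1 = 'X /\ phi U2 = 'X, phi V1 = 0 & phi V2 = 'X * 'X%:P].
Proof.
(* The values of the four variables come from solving [U1 = U2 = t], [V1 = 0], [V2 = t s] by
   Cramer's rule; [u] and [v] are those of [y1] and [y2] divided by [t]. *)
pose u : {poly C} := (d^-1 * (A + b))%:P - (d^-1 * b) *: 'X.
pose v : {poly C} := d^-1%:P + d^-1 *: 'X.
pose h : 4.-tuple S := [tuple (d^-1 * (A + b))%:P%:P * 'X; (d^-1)%:P%:P * 'X; u%:P * 'X; v%:P * 'X].
have [p0 p1 p2 p3] := eval4_pvarE ((d^-1 * (A + b))%:P%:P * 'X) ((d^-1)%:P%:P * 'X)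
  (u%:P * 'X) (v%:P * 'X).
have [phi [phiC phi0 [{}p0 {}p1 {}p2 {}p3] phi_lin2]] : exists phi : {rmorphism Pol -> S},
  [/\ forall c, phi c%:MP = c%:P%:P, forall p, p@_0%MM = 0 -> (phi p)`_0 = 0,
    [/\ phi (pvar R 0) = (d^-1 * (A + b))%:P%:P * 'X, phi (pvar R 1) = (d^-1)%:P%:P * 'X,
        phi (pvar R 2) = u%:P * 'X & phi (pvar R 3) = v%:P * 'X] &
    forall x y a c, phi (lin2 x y a c) = a%:P%:P * phi x + c%:P%:P * phi y].
  exists (eval4 h); split; [exact: eval4C | | exact: And4 p0 p1 p2 p3 | exact: eval4_lin2].
  move=> p p00; rewrite eval4_coef0 ?p00 // => i.
  by case: i => -[|[|[|[|//]]]] i4; rewrite (tnth_nth 0) /= coefMX.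
have e1 : phi U1 = 1%:P%:P * ((d^-1 * (A + b))%:P%:P * 'X) + b%:P%:P * ((d^-1)%:P%:P * 'X).
  by apply: etrans (phi_lin2 _ _ _ _) _; congr (_ * _ + _ * _); [exact: p0 | exact: p1].
have e2 : phi U2 = 1%:P%:P * (u%:P * 'X) + b%:P%:P * (v%:P * 'X).
  by apply: etrans (phi_lin2 _ _ _ _) _; congr (_ * _ + _ * _); [exact: p2 | exact: p3].
have e3 : phi V1 = (-1)%:P%:P * ((d^-1 * (A + b))%:P%:P * 'X) +
    (A + b)%:P%:P * ((d^-1)%:P%:P * 'X).
  by apply: etrans (phi_lin2 _ _ _ _) _; congr (_ * _ + _ * _); [exact: p0 | exact: p1].
have e4 : phi V2 = (-1)%:P%:P * (u%:P * 'X) + (A + b)%:P%:P * (v%:P * 'X).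
  by apply: etrans (phi_lin2 _ _ _ _) _; congr (_ * _ + _ * _); [exact: p2 | exact: p3].
exists phi; split; [exact: phiC | exact: phi0 | | |].
- split.
    rewrite e1 !mulrA -!polyCM -!mulrDl -!polyCD.
    suff -> : 1 * (d^-1 * (A + b)) + b * d^-1 = 1 by rewrite !polyC1 mul1r.
    by rewrite -[RHS](mulVf d0) /d; ring.
  rewrite e2 !mulrA -!polyCM -!mulrDl -!polyCD.
  suff -> : 1%:P * u + b%:P * v = 1 by rewrite polyC1 mul1r.
  rewrite /u /v -!mul_polyC !polyCM.
  have : (d^-1)%:P * d%:P = 1 :> {poly C} by rewrite -polyCM mulVf ?polyC1.
  rewrite /d !polyCD polyCM polyC_natr => dE.
  by rewrite -[RHS]dE polyC1; ring.
- rewrite e3 !mulrA -!polyCM -!mulrDl -!polyCD.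
  suff -> : -1 * (d^-1 * (A + b)) + (A + b) * d^-1 = 0 by rewrite !polyC0 mul0r.
  by ring.
- rewrite e4 !mulrA -!polyCM -!mulrDl -!polyCD.
  suff -> : (-1)%:P * u + (A + b)%:P * v = 'X by rewrite mulrC.
  rewrite /u /v -!mul_polyC !polyCM.
  have : (d^-1)%:P * d%:P = 1 :> {poly C} by rewrite -polyCM mulVf ?polyC1.
  rewrite /d !polyCD polyCM polyC_natr => dE.
  by rewrite -[RHS]mul1r -dE polyCN polyC1; ring.
Qed.

End Forms.
End AltIdeal.

(** * Bigraded bases of the quotient *)

Section Bigraded.
Variable K : fieldType.
Local Notation Pol := {mpoly K[4]}.

Definition bideg (m : 'X_{1..4}) : nat * nat :=
  (m (inord 0) + m (inord 1), m (inord 2) + m (inord 3))%N.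

(** A predicate on bidegrees, and not a single bidegree, covers both a homogeneous component and its
    complement. *)
Definition bisupp (Q : nat * nat -> Prop) (p : Pol) : Prop :=
  forall m, m \in msupp p -> Q (bideg m).

Definition bihomog (ab : nat * nat) : Pol -> Prop := bisupp (eq^~ ab).

Lemma bidegD m1 m2 : bideg (m1 + m2)%MM =
  ((bideg m1).1 + (bideg m2).1, (bideg m1).2 + (bideg m2).2)%N.
Proof. by rewrite /bideg !mnmDE /=; congr (_, _); lia. Qed.

Lemma bideg0 : bideg 0%MM = (0, 0)%N.
Proof. by rewrite /bideg !mnm0E. Qed.

Lemma bideg_eq0 m : bideg m = (0, 0)%N -> m = 0%MM.
Proof.
move=> [/eqP]; rewrite addn_eq0 => /andP[/eqP h0 /eqP h1] /eqP.
rewrite addn_eq0 => /andP[/eqP h2 /eqP h3]; apply/mnmP => i; rewrite mnm0E.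
rewrite -(inord_val i); case: i => -[|[|[|[|//]]]] i4 //=.
Qed.

Lemma bisupp0 Q : bisupp Q 0.
Proof. by move=> m; rewrite msupp0. Qed.

Lemma bisuppD Q p q : bisupp Q p -> bisupp Q q -> bisupp Q (p + q).
Proof.
by move=> hp hq m /msuppD_le; rewrite mem_cat => /orP[/hp|/hq].
Qed.

Lemma bisuppN Q p : bisupp Q p -> bisupp Q (- p).
Proof. by move=> hp m; rewrite (perm_mem (msuppN p)); apply: hp. Qed.

Lemma bisupp_sum Q (T : Type) (s : seq T) (P : pred T) (f : T -> Pol) :
  (forall i, P i -> bisupp Q (f i)) -> bisupp Q (\sum_(i <- s | P i) f i).
Proof.
by move=> hf; apply: big_ind => //; [apply: bisupp0 | apply: bisuppD].
Qed.

Lemma bisuppM (Q Q1 Q2 : nat * nat -> Prop) p q :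
  (forall x y, Q1 x -> Q2 y -> Q (x.1 + y.1, x.2 + y.2)%N) ->
  bisupp Q1 p -> bisupp Q2 q -> bisupp Q (p * q).
Proof.
move=> hQ hp hq m /msuppM_le /allpairsP[[m1 m2] /= [/hp h1 /hq h2 ->]].
by rewrite bidegD; apply: hQ.
Qed.

Lemma bisuppZ Q c p : bisupp Q p -> bisupp Q (c *: p).
Proof. by move=> hp m /msuppZ_le; apply: hp. Qed.

Lemma bihomogM a b c d p q : bihomog (a, b) p -> bihomog (c, d) q ->
  bihomog (a + c, b + d)%N (p * q).
Proof. by apply: bisuppM => x y -> ->. Qed.

Lemma bihomog1 : bihomog (0, 0)%N 1.
Proof. by move=> m; rewrite msupp1 inE => /eqP ->; apply: bideg0. Qed.

Lemma bihomogX a b p n : bihomog (a, b) p -> bihomog (a * n, b * n)%N (p ^+ n).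
Proof.
move=> hp; elim: n => [|n IHn]; first by rewrite !muln0 expr0; apply: bihomog1.
by rewrite exprS !mulnS; apply: bihomogM.
Qed.

Lemma bihomog00 p : bihomog (0, 0)%N p -> p = (p@_0%MM)%:MP.
Proof.
move=> hp; apply/mpolyP => m; rewrite mcoeffC.
have [->|m0] := eqVneq m 0%MM; first by rewrite mulr1.
rewrite mulr0; apply/eqP; rewrite mcoeff_eq0; apply/negP => /hp /bideg_eq0 /eqP.
by rewrite (negPf m0).
Qed.

Lemma bisupp_disjoint Q Q' p : (forall x, Q x -> Q' x -> False) ->
  bisupp Q p -> bisupp Q' p -> p = 0.
Proof.
move=> dj hQ hQ'; apply: msuppnil0; case E : (msupp p) => [//|m s].
by have mp : m \in msupp p by [rewrite E mem_head]; case: (dj _ (hQ _ mp) (hQ' _ mp)).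
Qed.

Lemma bisupp_split (Q : pred (nat * nat)) p : exists p1 p2,
  [/\ p = p1 + p2, bisupp Q p1 & bisupp (fun x => ~~ Q x) p2].
Proof.
exists (\sum_(m <- msupp p | Q (bideg m)) p@_m *: 'X_[m]),
  (\sum_(m <- msupp p | ~~ Q (bideg m)) p@_m *: 'X_[m]).
split; first by rewrite {1}(mpolyE p) (bigID (fun m => Q (bideg m))).
  by apply: bisupp_sum => m Qm; apply: bisuppZ => m'; rewrite msuppX inE => /eqP ->.
by apply: bisupp_sum => m Qm; apply: bisuppZ => m'; rewrite msuppX inE => /eqP ->.
Qed.

Variables (U1 U2 V1 V2 : Pol) (k m : nat).
Hypotheses (hU1 : bihomog (1, 0)%N U1) (hV1 : bihomog (1, 0)%N V1).
Hypotheses (hU2 : bihomog (0, 1)%N U2) (hV2 : bihomog (0, 1)%N V2).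

Definition Gbideg (j c : nat) : nat * nat := (m - j + c, m - j + (j * k - c))%N.

Lemma Dgen_bihomog : bihomog (1, 1)%N (Dgen U1 U2 V1 V2).
Proof.
by apply: bisuppD; [|apply: bisuppN];
  [apply: (bihomogM hU1 hV2) | apply: (bihomogM hV1 hU2)].
Qed.

Lemma Egen_bihomog a : bihomog (a, k - a)%N (Egen U1 U2 V1 V2 k a).
Proof.
have h x y : bihomog (1, 0)%N x -> bihomog (0, 1)%N y ->
    bihomog (a, k - a)%N (x ^+ a * y ^+ (k - a)).
  move=> hx hy; have := bihomogM (bihomogX (n := a) hx) (bihomogX (n := k - a) hy).
  by rewrite !mul1n !mul0n addn0.
by apply: bisuppD; [|apply: bisuppN]; apply: h.
Qed.

Lemma Fgen_bihomog j c : (c <= j * k)%N -> bihomog (c, j * k - c)%N (Fgen U1 U2 V1 V2 k j c).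
Proof.
elim: j c => [|j IHj] c cj /=.
  by have -> : c = 0%N by [lia]; apply: bihomog1.
have := bihomogM (@Egen_bihomog (minn k c)) (IHj (c - k)%N _).
have -> : (minn k c + (c - k) = c)%N by lia.
have -> : (k - minn k c + (j * k - (c - k)) = j.+1 * k - c)%N by lia.
by apply; lia.
Qed.

Lemma Ggen_bihomog j c : (c <= j * k)%N -> bihomog (Gbideg j c) (Ggen U1 U2 V1 V2 k m j c).
Proof.
move=> cj; have := bihomogM (bihomogX (n := m - j) Dgen_bihomog) (Fgen_bihomog cj).
by rewrite !mul1n.
Qed.

Local Notation G := (Ggen U1 U2 V1 V2 k m).
Definition Nset : set Pol := imul [set p : Pol | p@_0%MM = 0] (ipow (gideal U1 U2 V1 V2 k) m).

Lemma Nset_mem r j c : (j <= m)%N -> (c <= j * k)%N -> r@_0%MM = 0 -> Nset (r * G j c).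
Proof.
move=> jm cj r0; apply: imul_mem => //.
by rewrite ipow_gideal; apply: igen_mem; exists j, c.
Qed.

(** The shape in which [Ggen_indep] accepts its right-hand side: coefficients without constant term
    in front of the generators themselves. *)
Definition Gcomb0 : set Pol :=
  [set x | exists (n : nat) (r : 'I_n -> Pol) (jj cc : 'I_n -> nat),
  [/\ forall l, (jj l <= m)%N, forall l, (cc l <= jj l * k)%N, forall l, (r l)@_0%MM = 0 &
      x = \sum_(l < n) r l * G (jj l) (cc l)]].

Lemma Gcomb0_ideal : is_ideal Gcomb0.
Proof.
split.
- by exists 0%N, (fun=> 0), (fun=> 0%N), (fun=> 0%N); split=> [[]|[]|[]|] //; rewrite big_ord0.
- move=> x y [n1 [r1 [j1 [c1 [hj1 hc1 hr1 ->]]]]] [n2 [r2 [j2 [c2 [hj2 hc2 hr2 ->]]]]].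
  exists (n1 + n2)%N.
  exists (fun i => match fintype.split i with inl j => r1 j | inr j => r2 j end).
  exists (fun i => match fintype.split i with inl j => j1 j | inr j => j2 j end).
  exists (fun i => match fintype.split i with inl j => c1 j | inr j => c2 j end).
  split; try by move=> i; case: fintype.split.
  rewrite big_split_ord /=; congr (_ + _); apply: eq_bigr => i _.
    by rewrite (unsplitK (inl _ i)).
  by rewrite (unsplitK (inr _ i)).
- move=> s x [n [r [jj [cc [hj hc hr ->]]]]]; exists n, (fun l => s * r l), jj, cc; split=> //.
    by move=> l; rewrite rmorphM /= hr mulr0.
  by rewrite mulr_sumr; apply: eq_bigr => l _; rewrite mulrA.
Qed.

Lemma ipow_Gcomb x : ipow (gideal U1 U2 V1 V2 k) m x ->
  exists (n : nat) (r : 'I_n -> Pol) (jj cc : 'I_n -> nat),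
  [/\ forall l, (jj l <= m)%N, forall l, (cc l <= jj l * k)%N &
      x = \sum_(l < n) r l * G (jj l) (cc l)].
Proof.
rewrite ipow_gideal => -[n [r [f [Sf ->]]]].
have /choice[jc jcP] : forall l, exists jc : nat * nat,
    [/\ (jc.1 <= m)%N, (jc.2 <= jc.1 * k)%N & f l = G jc.1 jc.2].
  move=> l.
  by have [j [c h]] := Sf l; exists (j, c).
exists n, r, (fun l => (jc l).1), (fun l => (jc l).2).
split; try by move=> l; have [] := jcP l.
by apply: eq_bigr => l _; have [_ _ ->] := jcP l.
Qed.

Lemma Nset_Gcomb0 x : Nset x -> Gcomb0 x.
Proof.
apply: imul_min; first exact: Gcomb0_ideal.
move=> p y /= p0 /ipow_Gcomb[n [r [jj [cc [hj hc ->]]]]].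
exists n, (fun l => p * r l), jj, cc; split=> //.
  by move=> l; rewrite rmorphM /= p0 mul0r.
by rewrite mulr_sumr; apply: eq_bigr => l _; rewrite mulrA.
Qed.

Section Degree.
Variables a b : nat.
Variable phi : {rmorphism Pol -> {poly {poly K}}}.
Hypotheses (k2 : (2 <= k)%N) (phiC : forall c, phi c%:MP = c%:P%:P)
  (phi0 : forall p : Pol, p@_0%MM = 0 -> (phi p)`_0 = 0)
  (phiU1 : phi U1 = 'X) (phiU2 : phi U2 = 'X)
  (phiV1 : phi V1 = 0) (phiV2 : phi V2 = 'X * ('X)%:P).

(** The first degree forces [c = a - (m - j)], so each [j] provides at most one generator of
    bidegree [(a, b)], namely [gen j]. *)
Definition degs : {pred 'I_m.+1} :=
  [pred j : 'I_m.+1 | [exists c : 'I_(j * k).+1, Gbideg j c == (a, b)]].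

Definition gen (j : nat) : Pol := G j (a - (m - j)).

Lemma degsP (j : 'I_m.+1) : j \in degs ->
  (a - (m - j) <= j * k)%N /\ Gbideg j (a - (m - j)) = (a, b).
Proof.
case/existsP => c; have := ltn_ord c; rewrite /Gbideg => cj /eqP[<- <-].
by rewrite addKn; split.
Qed.

Lemma gen_indep (c : 'I_#|degs| -> K) :
  Nset (\sum_(i < #|degs|) c i *: gen (enum_val i)) -> forall i, c i = 0.
Proof.
case/Nset_Gcomb0 => n [r [jj [cc [hj hc hr eqN]]]].
(* Reindexes the coefficients by [j] itself; off [degs] the sum is empty and gives 0. *)
pose al (j : nat) := \sum_(i < #|degs| | enum_val i == j :> nat) c i.
have alE (i : 'I_#|degs|) : al (enum_val i : 'I_m.+1) = c i.
  rewrite /al (big_pred1 i) // => i'; rewrite (inj_eq val_inj) (inj_eq enum_val_inj).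
  by [].
suff al0 j : (j <= m)%N -> al j = 0 by move=> i; rewrite -alE al0 // -ltnS ltn_ord.
move=> jm; apply: (@Ggen_indep _ _ U1 U2 V1 V2 phi (@mpolyC 4 K) k m k2 phiC phiU1 phiU2 phiV1 phiV2
  (a + b)%N n al (fun j => a - (m - j))%N r jj cc _ hj _ _ j jm) => {j jm}.
- move=> j; apply: contraNeq => dj; rewrite /al big_pred0 // => i; apply/eqP => ij.
  have [le_j [ea eb]] := degsP (enum_valP i); rewrite -> ij in ea, eb, le_j.
  by case/eqP: dj; rewrite /Gdeg; move: (j * k)%N le_j ea eb => jk; clear; lia.
- by move=> l; apply: phi0.
rewrite -eqN; symmetry.
rewrite (eq_bigr (fun i => \sum_(j < m.+1 | enum_val i == j) (c i)%:MP * gen j)); last first.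
  by move=> i _; rewrite (big_pred1 (enum_val i)) ?mul_mpolyC // => j; rewrite eq_sym.
rewrite (exchange_big_dep xpredT) //=; apply: eq_bigr => j _.
by rewrite -mulr_suml -rmorph_sum.
Qed.

(** Each coefficient [r l] can be cut down to the component that brings its generator to bidegree
    [(a, b)], since what is dropped has support both inside and outside that bidegree. The remaining
    component is a constant if the generator already has bidegree [(a, b)], and otherwise has no
    constant term, so that its product lies in [Nset]. *)
Lemma gen_span p : ipow (gideal U1 U2 V1 V2 k) m p -> bihomog (a, b) p ->
  exists c : 'I_#|degs| -> K, Nset (p - \sum_(i < #|degs|) c i *: gen (enum_val i)).
Proof.
case/ipow_Gcomb => n [r [jj [cc [hj hc pE]]]] hp.
pose Q l : pred (nat * nat) := fun x =>
  ((x.1 + (Gbideg (jj l) (cc l)).1, x.2 + (Gbideg (jj l) (cc l)).2)%N == (a, b)).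
have /choice[r1 r1P] : forall l, exists p1 p2,
    [/\ r l = p1 + p2, bisupp (Q l) p1 & bisupp (fun x => ~~ Q l x) p2].
  move=> l; have [p1 [p2 h]] := bisupp_split (Q l) (r l).
  by exists p1, p2.
have {}pE : p = \sum_(l < n) r1 l * G (jj l) (cc l).
  apply/eqP; rewrite -subr_eq0; apply/eqP.
  apply: (@bisupp_disjoint (eq^~ (a, b)) (fun x => x <> (a, b))) => //.
    apply: bisuppD => //; apply: bisuppN; apply: bisupp_sum => l _.
    have [r2 [_ h1 _]] := r1P l; apply: bisuppM h1 (Ggen_bihomog (hc l)).
    by move=> x y /eqP Qx ->.
  rewrite pE -sumrB; apply: bisupp_sum => l _; rewrite -mulrBl.
  have [r2 [-> _ h2]] := r1P l; rewrite addrC addKr.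
  by apply: bisuppM h2 (Ggen_bihomog (hc l)) => x y /eqP Qx ->.
have NI : is_ideal Nset by apply: igen_ideal.
have [N0 ND NM] := NI.
pose e l := (r1 l)@_0%MM.
have sub l : exists c : 'I_#|degs| -> K,
    Nset (r1 l * G (jj l) (cc l) - \sum_(i < #|degs|) c i *: gen (enum_val i)).
  have [r2 [_ h1 _]] := r1P l.
  have [dl|dl] := eqVneq (Gbideg (jj l) (cc l)) (a, b); last first.
    exists (fun=> 0); rewrite big1 ?subr0 => [|i _]; last by rewrite scale0r.
    apply: Nset_mem => //; apply/eqP; rewrite mcoeff_eq0; apply/negP => /h1.
    by rewrite /Q bideg0 !add0n -surjective_pairing (negPf dl).
  have jd : Ordinal (hj l : (jj l < m.+1)%N) \in degs.
    apply/existsP; exists (Ordinal (hc l : (cc l < (jj l * k).+1)%N)).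
    exact/eqP.
  exists (fun i => if i == enum_rank_in jd (Ordinal (hj l : (jj l < m.+1)%N)) then e l else 0).
  rewrite (bigD1 (enum_rank_in jd (Ordinal (hj l : (jj l < m.+1)%N)))) //= eqxx.
  rewrite big1 ?addr0 => [|i /negPf->]; last by rewrite scale0r.
  rewrite enum_rankK_in // /gen /=; have [<- _] := dl; rewrite addKn.
  rewrite (bihomog00 (p := r1 l)) -/(e l) ?mul_mpolyC ?subrr // => x /h1.
  rewrite /Q dl; case: (bideg x) => x1 x2 /= /eqP[ex1 ex2].
  by congr (_, _); move: ex1 ex2; clear; lia.
have [c cP] := choice sub.
exists (fun i => \sum_(l < n) c l i).
have -> : p - \sum_(i < #|degs|) (\sum_(l < n) c l i) *: gen (enum_val i) =
    \sum_(l < n) (r1 l * G (jj l) (cc l) - \sum_(i < #|degs|) c l i *: gen (enum_val i)).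
  rewrite sumrB -pE exchange_big /=; congr (_ - _); apply: eq_bigr => i _.
  by rewrite scaler_suml.
by apply: ideal_sum => // l _; apply: cP.
Qed.

End Degree.

End Bigraded.

(** A family independent modulo [N] is no longer than a spanning one, as a kernel vector of the
    coefficient matrix would give a relation. Used in both directions, this makes the [d] of
    [quot_dim_is] unique, so that [xget] returns it. *)
Lemma quotient_basis_le (K : fieldType) (V : lmodType K) (N A : V -> Prop) (d d' : nat)
    (f : 'I_d -> V) (f' : 'I_d' -> V) :
  N 0 -> (forall x y, N x -> N y -> N (x + y)) -> (forall c x, N x -> N (c *: x)) ->
  (forall j, A (f j)) ->
  (forall c : 'I_d -> K, N (\sum_(j < d) c j *: f j) -> forall j, c j = 0) ->
  (forall p, A p -> exists c : 'I_d' -> K, N (p - \sum_(j < d') c j *: f' j)) ->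
  (d <= d')%N.
Proof.
move=> N0 ND NZ Af indep span.
have /choice[c cN] : forall i, exists c : 'I_d' -> K, N (f i - \sum_(j < d') c j *: f' j).
  by move=> i; apply: span.
pose M : 'M[K]_(d, d') := \matrix_(i, j) c i j.
rewrite leqNgt; apply/negP => ltd.
have : kermx M != 0.
  by rewrite kermx_eq0 /row_free neq_ltn (leq_ltn_trans (rank_leq_col M) ltd).
case/rowV0Pn => u /sub_kermxP uM; case/eqP; apply/rowP => i; rewrite mxE.
apply: (indep (fun i => u 0 i)).
have -> : \sum_(j < d) u 0 j *: f j =
    \sum_(j < d) u 0 j *: (f j - \sum_(l < d') c j l *: f' l).
  rewrite [RHS](eq_bigr (fun j => u 0 j *: f j - \sum_(l < d') (u 0 j * c j l) *: f' l)).
    rewrite sumrB exchange_big /= [X in _ - X]big1 ?subr0 // => l _.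
    rewrite -scaler_suml; have /rowP/(_ l) := uM; rewrite !mxE => uMl.
    by rewrite (eq_bigr (fun i => u 0 i * M i l)) ?uMl ?scale0r // => j _; rewrite mxE.
  by move=> j _; rewrite scalerBr scaler_sumr; congr (_ - _); apply: eq_bigr => l _; rewrite scalerA.
by apply: big_ind => // j _; apply: NZ.
Qed.

(** Groups a list by key. Only keys that occur contribute, which yields the finite support on which
    the sum over all bidegrees in [Cat] depends. *)
Lemma fsbig_key (V : nmodType) (I : choiceType) (T : eqType) (s : seq T) (key : T -> I) (g : T -> V) :
  \sum_(i \in @classical_sets.setT I) \sum_(x <- s) (if key x == i then g x else 0) =
  \sum_(x <- s) g x.
Proof.
pose r := undup (map key s).
rewrite (fsbigE r) ?undup_uniq //; last first.
  move=> i _; rewrite mem_undup => ir; rewrite big1_seq // => x /andP[_ xs].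
  by case: eqP => // kx; rewrite -kx map_f in ir.
rewrite (eq_bigl xpredT) => [|i]; last by rewrite in_setT.
rewrite exchange_big /=; apply: eq_big_seq => x xs.
rewrite (bigD1_seq (key x)) ?undup_uniq ?mem_undup ?map_f //= eqxx big1 ?addr0 // => i.
by rewrite eq_sym => /negPf ->.
Qed.

(** * The Hilbert series at [t = 1] *)

Section Catalan.
Variable R : realType.
Local Notation C := R[i].
Local Notation Pol := (mpoly.mpoly 4 R[i]).

Lemma bihomP a b (p : Pol) : bihom a b p <-> bihomog (a, b) p.
Proof. by split=> h m /h; [case=> <- <- | case=> <- <-]. Qed.

Lemma pvar_bihomog (i : 'I_4) :
  bihomog (if (i < 2)%N then (1, 0)%N else (0, 1)%N) (pvar R i).
Proof.
move=> m; rewrite /pvar inord_val msuppX inE => /eqP ->.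
by rewrite /bideg !mnm1E -!val_eqE /= !inordK //; case: i => -[|[|[|[|//]]]].
Qed.

Lemma altideal_structure k : k \in [:: 2; 3; 4; 6]%N ->
  exists (U1 U2 V1 V2 : Pol) (phi : {rmorphism Pol -> {poly {poly C}}}),
  [/\ altideal k = gideal U1 U2 V1 V2 k,
      [/\ bihomog (1, 0)%N U1, bihomog (1, 0)%N V1, bihomog (0, 1)%N U2 & bihomog (0, 1)%N V2],
      forall c, phi c%:MP = c%:P%:P,
      forall p, p@_0%MM = 0 -> (phi p)`_0 = 0 &
      [/\ phi U1 = 'X, phi U2 = 'X, phi V1 = 0 & phi V2 = 'X * 'X%:P]].
Proof.
move=> hk.
have [||z [zi [b [pz zz d0 bB bA]]]] := @eigenform_exists C k (- (cartan k 0 1)%:~R) (- (cartan k 1 0)%:~R).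
- by move=> n; rewrite pnatr_eq0.
- move: hk; rewrite !inE => /or4P[] /eqP ->; [apply: Or41 | apply: Or42 | apply: Or43 | apply: Or44];
    by split=> //; rewrite !mxE /= -rmorphN ?oppr0 ?opprK.
have [phi [phiC phi0 [u1 u2] v1 v2]] := forms_eval d0.
exists (formU1 b), (formU2 b), (formV1 k b), (formV2 k b), phi; split=> //.
  exact: altideal_forms pz zz d0 bB bA.
have h (i j : 'I_4) x y ab : bihomog ab (pvar R i) -> bihomog ab (pvar R j) ->
    bihomog ab (lin2 (pvar R i) (pvar R j) x y).
  by move=> hi hj; apply: bisuppD; apply: bisuppZ.
have h0 := @pvar_bihomog (@Ordinal 4 0 isT); have h1 := @pvar_bihomog (@Ordinal 4 1 isT).
have h2 := @pvar_bihomog (@Ordinal 4 2 isT); have h3 := @pvar_bihomog (@Ordinal 4 3 isT).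
by split; [apply: h h0 h1 | apply: h h0 h1 | apply: h h2 h3 | apply: h h2 h3].
Qed.

Lemma quot_dimE k m a b : k \in [:: 2; 3; 4; 6]%N ->
  quot_dim R k m a b = #|@degs k m a b|.
Proof.
move=> hk; have [U1 [U2 [V1 [V2 [phi [aE [hU1 hV1 hU2 hV2] phiC phi0 [u1 u2 v1 v2]]]]]]] :=
  altideal_structure hk.
have k2 : (2 <= k)%N by move: hk; rewrite !inE => /or4P[] /eqP ->.
have AmE : ideal_pow (altideal k) m = ipow (gideal U1 U2 V1 V2 k) m by rewrite -aE.
have NmE : ideal_mul (@maxideal R) (ideal_pow (altideal k) m) = Nset U1 U2 V1 V2 k m.
  by rewrite AmE.
have NI : is_ideal (Nset U1 U2 V1 V2 k m) by apply: igen_ideal.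
have [N0 ND NM] := NI.
have isd : quot_dim_is R k m a b #|@degs k m a b|.
  exists (fun i : 'I_#|@degs k m a b| => gen U1 U2 V1 V2 k m a (enum_val i : 'I_m.+1)).
  rewrite AmE; split.
  - move=> i; have := enum_valP i; move: (enum_val i) => j jd.
    have [le_c bE] := degsP jd; split.
      rewrite ipow_gideal; apply: igen_mem.
      by exists j, (a - (m - j))%N; split=> //; rewrite -ltnS.
    by apply/bihomP; rewrite -bE; apply: Ggen_bihomog.
  - by move=> c; rewrite -AmE NmE; apply: gen_indep phi0 u1 u2 v1 v2 _.
  - move=> p Ap /bihomP hp; rewrite -AmE NmE.
    by have := gen_span hU1 hV1 hU2 hV2 Ap hp.
have NZ c x : Nset U1 U2 V1 V2 k m x -> Nset U1 U2 V1 V2 k m (c *: x).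
  by rewrite -mul_mpolyC; apply: NM.
apply: xget_unique => //= d [f [Af indep span]].
case: isd => f' [Af' indep' span']; rewrite NmE in indep indep' span span'.
pose A (p : Pol) := ideal_pow (altideal k) m p /\ bihom a b p.
apply/eqP; rewrite eqn_leq; apply/andP; split.
  have := @quotient_basis_le C Pol _ A d _ f f' N0 ND NZ Af indep.
  by apply=> p [Ap bp]; apply: span'.
have := @quotient_basis_le C Pol _ A _ d f' f N0 ND NZ Af' indep'.
by apply=> p [Ap bp]; apply: span.
Qed.

Lemma card_degs k m a b :
  #|@degs k m a b| = (\sum_(j < m.+1) \sum_(c < (j * k).+1) (Gbideg k m j c == (a, b)))%N.
Proof.
rewrite -sum1_card big_mkcond; apply: eq_bigr => j _.
rewrite inE; case: existsP => [[c cP]|nc].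
  rewrite (bigD1 c) //= cP big1 // => c' c'c; apply/eqP; rewrite eqb0.
  apply: contraNN c'c; rewrite -(eqP cP) => /eqP[/addnI cc _].
  by apply/eqP/val_inj.
by rewrite big1 // => c _; apply/eqP; rewrite eqb0; apply/negP => h; case: nc; exists c.
Qed.

Lemma Cat_q1E k m : k \in [:: 2; 3; 4; 6]%N ->
  Cat_q1 R k m = \sum_(j < m.+1) \sum_(c < (j * k).+1) 'X^(m - j + c).
Proof.
move=> hk.
pose s := [seq (j, c) | j <- iota 0 m.+1, c <- iota 0 (j * k).+1].
pose g (x : nat * nat) : {poly {poly int}} :=
  ('X^((Gbideg k m x.1 x.2).1) : {poly int})%:P * 'X^((Gbideg k m x.1 x.2).2).
have sumE (V : nmodType) (h : nat -> nat -> V) :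
    \sum_(j < m.+1) \sum_(c < (j * k).+1) h j c = \sum_(x <- s) h x.1 x.2.
  rewrite -(big_mkord xpredT (fun j => \sum_(c < (j * k).+1) h j c)) /index_iota subn0.
  rewrite /s big_allpairs_dep; apply: eq_bigr => j _.
  by rewrite -(big_mkord xpredT (h j)) /index_iota subn0.
have -> : Cat_q1 R k m = (\sum_(x <- s) g x).[1].
  rewrite /Cat_q1 /Cat -(fsbig_key s (fun x => Gbideg k m x.1 x.2)); congr (_.[1]).
  apply: eq_fsbigr => -[a b] _ /=; rewrite quot_dimE // card_degs.
  rewrite -(sumE _ (fun j c => if Gbideg k m j c == (a, b) then g (j, c) else 0)).
  rewrite natr_sum !mulr_suml; apply: eq_bigr => j _.
  rewrite natr_sum !mulr_suml; apply: eq_bigr => c _.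
  by case: eqP => [[<- <-]|_]; rewrite ?mul0r ?mul1r.
rewrite (sumE _ (fun j c => 'X^(m - j + c))) horner_sum; apply: eq_bigr => x _.
by rewrite /g hornerM hornerC hornerXn expr1n mulr1.
Qed.

End Catalan.

(** * Representative points and their heights *)

Section LatticePoints.
Local Open Scope nat_scope.

(** The positive roots of [G2], ordered so that the prefixes of length 2, 3 and 4 are those of
    [A1 x A1], [A2] and [B2]. *)
Definition posroot_seq (k : nat) : seq (nat * nat) :=
  take k [:: (1, 0); (0, 1); (1, 1); (2, 1); (3, 1); (3, 2)].

(* The point with coordinates [(P.1 / 48, P.2 / 48)] lies beyond exactly
   [level m P a] of the hyperplanes [(a, x) = j], [1 <= j <= m]. *)
Definition level (m : nat) (P a : nat * nat) : nat := minn m ((a.1 * P.1 + a.2 * P.2) %/ 48).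

Definition levels (k m : nat) (P : nat * nat) : seq nat :=
  [seq level m P a | a <- posroot_seq k].

(* [1 / 48] and [1 / 4] keep the points of the chain off all the walls. *)
Definition chain_pt (n t : nat) : nat * nat := (t.*2.+1, 48 * n + 12).

Definition chain_ht (k m n t : nat) : nat := sumn (levels k m (chain_pt n t)).

Definition chain_bot (k m n : nat) : nat := chain_ht k m n 0.

(** At [y = n + 1/4] the walls sit at abscissae that are multiples of [1/24], and the chain visits
    the midpoints between consecutive multiples. The residues record which multiples belong to which
    root; no two of them are compatible, so no step passes two walls. *)
Lemma chain_jumps (k m n t : nat) :
  [/\ level m (chain_pt n t) (1, 0) <= level m (chain_pt n t.+1) (1, 0)
        <= level m (chain_pt n t) (1, 0) + (t.+1 %% 24 == 0),
      level m (chain_pt n t) (1, 1) <= level m (chain_pt n t.+1) (1, 1)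
        <= level m (chain_pt n t) (1, 1) + (t.+1 %% 24 == 18),
      level m (chain_pt n t) (2, 1) <= level m (chain_pt n t.+1) (2, 1)
        <= level m (chain_pt n t) (2, 1) + (t.+1 %% 12 == 9),
      level m (chain_pt n t) (3, 1) <= level m (chain_pt n t.+1) (3, 1)
        <= level m (chain_pt n t) (3, 1) + (t.+1 %% 8 == 6) &
      level m (chain_pt n t) (3, 2) <= level m (chain_pt n t.+1) (3, 2)
        <= level m (chain_pt n t) (3, 2) + (t.+1 %% 8 == 4)].
Proof. by rewrite /level /chain_pt /=; split; lia. Qed.

Lemma chain_step (k m n t : nat) : k \in [:: 2; 3; 4; 6] ->
  chain_ht k m n t <= chain_ht k m n t.+1 <= (chain_ht k m n t).+1.
Proof.
have [] := chain_jumps k m n t; rewrite /chain_ht /levels.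
have : level m (chain_pt n t.+1) (0, 1) = level m (chain_pt n t) (0, 1) by [].
have : (t.+1 %% 24 == 0) + (t.+1 %% 24 == 18) + (t.+1 %% 12 == 9) + (t.+1 %% 8 == 6)
  + (t.+1 %% 8 == 4) <= 1 by lia.
by move=> jump eq01 h10 h11 h21 h31 h32; rewrite !inE => /or4P[] /eqP ->;
  rewrite /= !addn0; lia.
Qed.

Lemma chain_botE (k m n : nat) : k \in [:: 2; 3; 4; 6] -> n <= m ->
  chain_bot k m n = sumn [seq minn m (a.2 * n) | a <- posroot_seq k].
Proof.
by rewrite !inE => /or4P[] /eqP -> nm; rewrite /chain_bot /chain_ht /levels /level /chain_pt /=; lia.
Qed.

(** At [t = 24 * m.+1] the abscissa exceeds [m + 1], so every root except [(0, 1)] has reached level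
    [m]. *)
Lemma chain_top (k m n : nat) : k \in [:: 2; 3; 4; 6] -> n <= m ->
  chain_ht k m n (24 * m.+1) = (k.-1 * m + n)%N.
Proof.
by rewrite !inE => /or4P[] /eqP -> nm; rewrite /chain_ht /levels /level /chain_pt /=; lia.
Qed.

Definition chain_idx (k m n h : nat) : nat :=
  find (fun t => chain_ht k m n t == h) (iota 0 (24 * m.+1).+1).

(** A discrete intermediate value argument: the height grows by at most one per step of the
    chain. *)
Lemma chain_idxP (k m n h : nat) : k \in [:: 2; 3; 4; 6] -> n <= m ->
  chain_bot k m n <= h <= k.-1 * m + n -> chain_ht k m n (chain_idx k m n h) = h.
Proof.
move=> hk nm /andP[bh ht].
have hasP : has (fun t => chain_ht k m n t == h) (iota 0 (24 * m.+1).+1).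
  have key T : chain_bot k m n <= h <= chain_ht k m n T ->
      exists2 t, t <= T & chain_ht k m n t = h.
    elim: T => [|T IHT] /andP[b t]; first by exists 0 => //; apply/eqP; rewrite eqn_leq t b.
    have /andP[s1 s2] := @chain_step k m n T hk.
    have [le|lt] := leqP h (chain_ht k m n T).
      by have [|x xT xE] := IHT; [rewrite b | exists x => //; apply: leqW].
    by exists T.+1 => //; lia.
  have [|t tT tE] := key (24 * m.+1); first by rewrite chain_top // bh.
  by apply/hasP; exists t; [rewrite mem_iota | apply/eqP].
have := nth_find 0 hasP; rewrite nth_iota ?add0n; first by move/eqP.
by rewrite has_find size_iota in hasP.
Qed.

Definition chain_pts (k m : nat) : seq (nat * nat) :=
  [seq chain_pt n (chain_idx k m n h) | n <- iota 0 m.+1,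
     h <- index_iota (chain_bot k m n) (k.-1 * m + n).+1].

(* Points near the crossings of [x = u, 3x + 2y = 3u + 2n + 1], respectively of
   [x + y = u + n + 1, 3x + y = 3u + n + 2], both at height [y = n + 1/2]. *)
Definition even_pt (u n : nat) : nat * nat := (48 * u - 4, 48 * n + 36).
Definition odd_pt (u n : nat) : nat * nat := (48 * u + 16, 48 * n + 36).

(** Inverts the height formula. The heights [10 u + 6 n] at [even_pt u n] and [10 u + 6 n + 5] at
    [odd_pt u n] are [5 v + s] with [s = n] and [v - s] equal to [2 u] or [2 u + 1]. If the level of
    [(3, 2)] is cut off at [m], the height at [odd_pt u n] is [7 u + 4 n + 3 + m], which gives the
    last line; the test on [3 * v + s] tells the two regimes apart. *)
Definition extra_pt (m v s : nat) : nat * nat :=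
  if 3 * v + s < m.*2 then
    if odd (v - s) then odd_pt (v - s)./2 s else even_pt (v - s)./2 s
  else odd_pt (m - s - 1 - v) (3 * v + s.*2 + 1 - m.*2).

Definition extra_pts (m : nat) : seq (nat * nat) :=
  [seq extra_pt m v s | v <- iota 0 m.+1, s <- iota 0 (minn v (m - v))].

Definition shi_pts (k m : nat) : seq (nat * nat) :=
  chain_pts k m ++ (if k == 6 then extra_pts m else [::]).

Lemma extra_ptP (m v s : nat) : s < minn v (m - v) ->
  exists u n, [\/ [/\ 0 < u, 3 * u + n.*2 + 1 <= m, extra_pt m v s = even_pt u n,
       v = u.*2 + n & s = n],
     [/\ 3 * u + n.*2 + 2 <= m, extra_pt m v s = odd_pt u n, v = u.*2 + n + 1 & s = n] |
     [/\ m < 3 * u + n.*2 + 2, 3 * u + n + 2 <= m, extra_pt m v s = odd_pt u n,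
       v = u.*2 + n + 1 & s = m - (3 * u + n + 2)]].
Proof.
move=> lt_s; rewrite /extra_pt; case: ltnP => [lt|le]; last first.
  exists (m - s - 1 - v), (3 * v + s.*2 + 1 - m.*2); apply: Or33; split=> //; lia.
exists (v - s)./2, s; case: ifP => [ho|/negbT ho]; [apply: Or32 | apply: Or31]; split=> //; lia.
Qed.

Lemma even_pt_levels (m u n : nat) : 0 < u -> 3 * u + n.*2 + 1 <= m ->
  levels 6 m (even_pt u n) =
  [:: u.-1; n; u + n; u.*2 + n; 3 * u + n; 3 * u + n.*2 + 1].
Proof.
move=> u0 um; rewrite /levels /level /even_pt /=.
by congr [:: _; _; _; _; _; _]; lia.
Qed.

Lemma odd_pt_levels (m u n : nat) : 3 * u + n + 2 <= m ->
  levels 6 m (odd_pt u n) =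
  [:: u; n; u + n + 1; u.*2 + n + 1; 3 * u + n + 1; minn m (3 * u + n.*2 + 2)].
Proof.
move=> um; rewrite /levels /level /odd_pt /=.
by congr [:: _; _; _; _; _; _]; lia.
Qed.

Lemma extra_ht (m v s : nat) : s < minn v (m - v) ->
  sumn (levels 6 m (extra_pt m v s)) = (5 * v + s)%N.
Proof.
move=> /extra_ptP[u [n [[u0 um -> -> ->]|[um -> -> ->]|[mu um -> -> ->]]]].
- by rewrite even_pt_levels //=; lia.
- by rewrite odd_pt_levels //=; lia.
- by rewrite odd_pt_levels //=; lia.
Qed.

(** With [y = n + 1/4], the inequality [x < u] implies [3 x + 2 y < 3 u + 2 n + 1], and
    [x + y > u + n + 1] implies [3 x + y > 3 u + n + 2]: the line passes below both kinds of
    crossing. *)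
Lemma chain_neq_extra (m n t v s : nat) : s < minn v (m - v) -> n <= m ->
  levels 6 m (chain_pt n t) != levels 6 m (extra_pt m v s).
Proof.
move=> /extra_ptP[u [p [[u0 um -> _ _]|[um -> _ _]|[mu um -> _ _]]]] nm; apply/eqP.
- rewrite even_pt_levels // /levels /level /chain_pt /= => -[h10 h01 _ _ _ h32]; lia.
- rewrite odd_pt_levels /levels /level /chain_pt /=; last lia.
  by move=> -[h10 h01 h11 _ h31 _]; lia.
- rewrite odd_pt_levels /levels /level /chain_pt /=; last lia.
  by move=> -[h10 h01 h11 _ h31 _]; lia.
Qed.

(** The height [5 v + s] does not determine the pair, since [s] may exceed 4; the level of [(0, 1)],
    which is the strip, is used as well. *)
Lemma extra_inj (m v s v' s' : nat) : s < minn v (m - v) -> s' < minn v' (m - v') ->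
  levels 6 m (extra_pt m v s) = levels 6 m (extra_pt m v' s') -> v = v' /\ s = s'.
Proof.
move=> hs hs' e.
have := congr1 sumn e; rewrite !extra_ht //.
have := congr1 (fun l => nth 0 l 1) e.
case: (extra_ptP hs) => u [n [[u0 um -> vE sE]|[um -> vE sE]|[mu um -> vE sE]]];
case: (extra_ptP hs') => u' [n' [[u0' um' -> vE' sE']|[um' -> vE' sE']|[mu' um' -> vE' sE']]];
rewrite ?even_pt_levels ?odd_pt_levels //=; lia.
Qed.

Lemma allpairs_dep_uniq (T : eqType) (s : seq nat) (t : nat -> seq nat) (f : nat -> nat -> T) :
  uniq s -> (forall x, uniq (t x)) ->
  (forall x y x' y', x \in s -> y \in t x -> x' \in s -> y' \in t x' ->
    f x y = f x' y' -> x = x' /\ y = y') ->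
  uniq [seq f x y | x <- s, y <- t x].
Proof.
move=> us ut inj; apply: allpairs_uniq_dep => //.
move=> _ _ /allpairsPdep[x [y [xs yt ->]]] /allpairsPdep[x' [y' [xs' yt' ->]]] /= e.
by have [-> ->] := inj _ _ _ _ xs yt xs' yt' e.
Qed.

Lemma map_levels_chain (k m : nat) : map (levels k m) (chain_pts k m) =
  [seq levels k m (chain_pt n (chain_idx k m n h)) | n <- iota 0 m.+1,
     h <- index_iota (chain_bot k m n) (k.-1 * m + n).+1].
Proof. exact: map_allpairs. Qed.

Lemma levels_uniq (k m : nat) : k \in [:: 2; 3; 4; 6] -> uniq (map (levels k m) (shi_pts k m)).
Proof.
move=> hk; rewrite /shi_pts map_cat cat_uniq map_levels_chain; apply/and3P; split.
- apply: allpairs_dep_uniq => [|x|n h n' h']; rewrite ?iota_uniq //.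
  rewrite !mem_index_iota !mem_iota /= => nm /andP[bh ht] nm' /andP[bh' ht'] e.
  have hE : h = h'.
    by rewrite -(@chain_idxP k m n h) ?bh // -(@chain_idxP k m n' h') ?bh' // /chain_ht e.
  split=> //; have := congr1 (fun l => nth 0 l 1) e; move: hk; rewrite !inE.
  by case/or4P => /eqP ->; rewrite /levels /level /chain_pt /=; lia.
- case: eqP => [->|_] //; apply/hasPn => _ /mapP[_ /allpairsPdep[v [s [hv hs ->]]] ->].
  apply/negP => /allpairsPdep[n [h [hn _ e]]].
  have := @chain_neq_extra m n (chain_idx 6 m n h) v s; rewrite e eqxx.
  by rewrite !mem_iota /= in hs hn; move=> h'; have := h' hs hn.
- case: eqP => [->|_] //; rewrite /extra_pts map_allpairs.
  apply: allpairs_dep_uniq => [|x|v s v' s']; rewrite ?iota_uniq //.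
  by rewrite !mem_iota /= => _ hs _ hs'; apply: extra_inj.
Qed.

Lemma geometric_sum (M B E : nat) : B <= E <= M.+1 ->
  ((1 - 'X) * \sum_(B <= h < E) 'X^(M - h) = 'X^(M.+1 - E) - 'X^(M.+1 - B) :> {poly int})%R.
Proof.
elim: E => [|E IHE] /andP[BE EM].
  by move: BE; rewrite leqn0 => /eqP ->; rewrite big_geq // mulr0 subrr.
move: BE; rewrite leq_eqVlt => /orP[/eqP ->|BE]; first by rewrite big_geq // mulr0 subrr.
rewrite big_nat_recr //= mulrDr IHE; last lia.
by rewrite [in X in (X - _ + _)%R]subSn // exprS subSS; ring.
Qed.

Lemma geometric_sum_up (a n : nat) :
  ((1 - 'X) * \sum_(c < n.+1) 'X^(a + c) = 'X^a - 'X^((a + n).+1) :> {poly int})%R.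
Proof.
elim: n => [|n IHn].
  by rewrite big_ord_recl big_ord0 addr0 addn0 exprS; ring.
by rewrite big_ord_recr mulrDr IHn /= addnS !exprS; ring.
Qed.

Lemma chain_sum (k m : nat) (F : nat -> {poly int}) : k \in [:: 2; 3; 4; 6] ->
  (\sum_(P <- chain_pts k m) F (sumn (levels k m P)) =
  \sum_(n < m.+1) \sum_(chain_bot k m n <= h < (k.-1 * m + n).+1) F h)%R.
Proof.
move=> hk; rewrite /chain_pts big_allpairs_dep.
rewrite -(big_mkord xpredT (fun n => (\sum_(chain_bot k m n <= h < (k.-1 * m + n).+1) F h)%R)).
rewrite [in RHS]/index_iota subn0; apply: eq_big_seq => n; rewrite mem_iota => /= nm.
apply: eq_big_seq => h; rewrite mem_index_iota => /andP[bh ht].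
by rewrite -/(chain_ht k m n _) chain_idxP // bh.
Qed.

Lemma extra_sum (m : nat) (F : nat -> {poly int}) :
  (\sum_(P <- extra_pts m) F (sumn (levels 6 m P)) =
  \sum_(v < m.+1) \sum_(5 * v <= h < 5 * v + minn v (m - v)) F h)%R.
Proof.
rewrite /extra_pts big_allpairs_dep.
rewrite -(big_mkord xpredT (fun v => (\sum_(5 * v <= h < 5 * v + minn v (m - v)) F h)%R)).
rewrite [in RHS]/index_iota subn0; apply: eq_big_seq => v _.
rewrite /index_iota addKn -[in RHS](addn0 (5 * v)) iotaDl big_map.
by apply: eq_big_seq => s; rewrite mem_iota add0n => /andP[_ hs]; rewrite extra_ht.
Qed.

Lemma shi_pts_sum (k m : nat) : k \in [:: 2; 3; 4; 6] ->
  (\sum_(P <- shi_pts k m) 'X^(m * k - sumn (levels k m P)) =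
  \sum_(j < m.+1) \sum_(c < (j * k).+1) 'X^(m - j + c) :> {poly int})%R.
Proof.
move=> hk; have X1 : (1 - 'X != 0 :> {poly int})%R.
  by rewrite subr_eq0 eq_sym; apply/eqP => /(congr1 (fun p : {poly int} => size p)); rewrite size_polyX size_poly1.
apply: (mulfI X1); rewrite big_cat mulrDr /= (chain_sum m (fun h => 'X^(m * k - h))%R) //.
rewrite [RHS]mulr_sumr (eq_bigr _ (fun (j : 'I_m.+1) _ => geometric_sum_up (m - j) (j * k))).
rewrite mulr_sumr.
have botE (n : 'I_m.+1) : chain_bot k m n = (k.-1 * n + (k == 6) * minn n (m - n))%N.
  have nm : n <= m by rewrite -ltnS.
  by rewrite chain_botE //; move: hk nm; rewrite !inE => /or4P[] /eqP -> nm /=; lia.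
have k0 : 0 < k by move: hk; rewrite !inE => /or4P[] /eqP ->.
have k6 : (k == 6) <= (k.-1 - 1)%N by case: eqP => [->|].
have wlem (n : 'I_m.+1) : (k.-1 * n + (k == 6) * minn n (m - n) <= k.-1 * m + n)%N.
  have nm : n <= m by rewrite -ltnS.
  have : k.-1 * n <= k.-1 * m by rewrite leq_mul2l nm orbT.
  by case: eqP => [_|_] /=; lia.
rewrite (eq_bigr (fun n : 'I_m.+1 => ('X^(m - n) -
   'X^((m * k).+1 - (k.-1 * n + (k == 6) * minn n (m - n))))%R)); last first.
  move=> n _; have nm : n <= m by rewrite -ltnS.
  have mk : (m * k = k.-1 * m + m)%N by case: (k) k0 => // k' _; rewrite mulnS mulnC addnC.
  rewrite geometric_sum botE; last by apply/andP; split; [apply: leqW; apply: wlem | lia].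
  by congr (_ - _)%R; congr ('X^_)%R; lia.
(* For [k = 6] the extra points with [v = n] lower the starting height of the [n]-th chain from
   [5 n + min(n, m - n)] to [5 n]; for other [k] both sides vanish. *)
have extraE : ((1 - 'X) * (\sum_(P <- (if k == 6 then extra_pts m else [::]))
     'X^(m * k - sumn (levels k m P))) =
   \sum_(n < m.+1) ('X^((m * k).+1 - (k.-1 * n + (k == 6) * minn n (m - n))) -
     'X^((m * k).+1 - k.-1 * n)) :> {poly int})%R.
  case: eqP => [->|_] /=; last first.
    by rewrite big_nil mulr0 big1 // => n _; rewrite mul0n addn0 subrr.
  rewrite (extra_sum m (fun h => 'X^(m * 6 - h))%R) mulr_sumr; apply: eq_bigr => n _.
  by rewrite geometric_sum ?mul1n //; have := ltn_ord n; lia.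
rewrite extraE -big_split /= (eq_bigr (fun n : 'I_m.+1 => ('X^(m - n) - 'X^((m * k).+1 - k.-1 * n))%R)); last first.
  by move=> n _; rewrite addrA subrK.
(* The surviving powers correspond under [j = m - n]. *)
rewrite !sumrB; congr (_ - _)%R; rewrite (reindex_inj rev_ord_inj) /=.
apply: eq_bigr => n _; congr ('X^_)%R; rewrite subSS.
have nm : n <= m by rewrite -ltnS.
case: (k) k0 => // k' _ /=; rewrite !mulnS mulnBr [k' * n]mulnC [k' * m]mulnC.
have : n * k' <= m * k' by rewrite leq_mul2r nm orbT.
lia.
Qed.

End LatticePoints.

(** * Completeness of the list of points *)

Section RealPoints.
Variable R : realType.

Definition pair_val (x y : R) (a : nat * nat) : R := a.1%:R * x + a.2%:R * y.

(** At [r = m] the upper bound is void: beyond the last wall the value is unbounded. *)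
Definition has_level (m : nat) (v : R) (r : nat) : Prop :=
  [/\ (r <= m)%N, r%:R < v & (r < m)%N -> v < r.+1%:R].

Lemma has_level_exists m (v : R) : 0 < v ->
  (forall j, (1 <= j <= m)%N -> v != j%:R) -> exists r, has_level m v r.
Proof.
move=> v0 vj; have /andP[tv vt] := truncn_itv (ltW v0).
exists (minn m (Num.truncn v)); have [mt|tm] := ltnP m (Num.truncn v); split=> //.
- by apply: lt_le_trans tv; rewrite ltr_nat.
- by rewrite ltnn.
- rewrite lt_neqAle tv andbT; case: (posnP (Num.truncn v)) => [->|t0].
    by rewrite eq_sym gt_eqF.
  by rewrite eq_sym; apply: vj; rewrite t0.
Qed.

Lemma has_level_lt m (v : R) r i : has_level m v r -> (r < i <= m)%N -> v < i%:R.
Proof.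
move=> [rm rv vr] /andP[ri im]; apply: lt_le_trans (vr (leq_trans ri im)) _.
by rewrite ler_nat.
Qed.

Lemma has_level_ge m (v : R) r i : has_level m v r -> i%:R < v -> (minn m i <= r)%N.
Proof.
move=> lv iv; rewrite leqNgt; apply/negP; rewrite leq_min => /andP[rm ri].
have [_ _ /(_ rm) vr] := lv; have := lt_trans iv vr; rewrite ltr_nat; lia.
Qed.

(** Eliminating [x] between the two wall inequalities leaves one in [y], with coefficient the
    determinant of [a] and [b]. Its sign decides whether [n < y] or [y < n + 1] applies, and the
    result is an inequality between integers. *)
Lemma cross_walls (x y : R) (a b : nat * nat) (i j n : nat) : (0 < a.1)%N -> (0 < b.1)%N ->
  pair_val x y a < i%:R -> j%:R < pair_val x y b -> n%:R < y -> y < n.+1%:R ->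
  ((a.1 * b.2 <= b.1 * a.2)%N -> (a.1 * j + (b.1 * a.2 - a.1 * b.2) * n < b.1 * i)%N) /\
  ((b.1 * a.2 <= a.1 * b.2)%N -> (a.1 * j < b.1 * i + (a.1 * b.2 - b.1 * a.2) * n.+1)%N).
Proof.
case: a b => a1 a2 [b1 b2] /= a10 b10; rewrite /pair_val /= => hi hj hn hn1.
have {}hi : b1%:R * (a1%:R * x + a2%:R * y) < b1%:R * i%:R by rewrite ltr_pM2l // ltr0n.
have {}hj : a1%:R * j%:R < a1%:R * (b1%:R * x + b2%:R * y) by rewrite ltr_pM2l // ltr0n.
have key : a1%:R * j%:R + (b1%:R * a2%:R) * y < b1%:R * i%:R + (a1%:R * b2%:R) * y :> R.
  have e1 : b1%:R * (a1%:R * x + a2%:R * y) = b1%:R * a1%:R * x + b1%:R * a2%:R * y by ring.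
  have e2 : a1%:R * (b1%:R * x + b2%:R * y) = b1%:R * a1%:R * x + a1%:R * b2%:R * y by ring.
  by lra.
rewrite -!natrM in key; split=> le.
  have dn : (b1 * a2 - a1 * b2)%:R * n%:R <= (b1 * a2 - a1 * b2)%:R * y.
    by rewrite ler_wpM2l // ltW.
  rewrite -(ltr_nat R) natrD natrM; move: key; rewrite -(subnK le) natrD mulrDl.
  by rewrite addnK; lra.
have dn : (a1 * b2 - b1 * a2)%:R * y <= (a1 * b2 - b1 * a2)%:R * n.+1%:R.
  by rewrite ler_wpM2l // ltW.
rewrite -(ltr_nat R) natrD (natrM _ (_ - _)%N); move: key; rewrite -(subnK le) natrD mulrDl.
by rewrite addnK; lra.
Qed.

(** Two points of equal height either have the same levels or are separated by two walls passed in
    opposite directions. *)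
Lemma sumn_crossing (T : eqType) (s : seq T) (r l : T -> nat) :
  sumn (map r s) = sumn (map l s) ->
  {in s, r =1 l} \/ exists a b, [/\ a \in s, b \in s, (r a < l a)%N & (l b < r b)%N].
Proof.
have key (f g : T -> nat) : sumn (map f s) = sumn (map g s) -> {in s, forall a, (f a <= g a)%N} ->
    {in s, f =1 g}.
  elim: s => [//|c s IHs] /= e le.
  have les : (sumn (map f s) <= sumn (map g s))%N.
    have : {in s, forall a, (f a <= g a)%N} by move=> a sa; apply: le; rewrite inE sa orbT.
    elim: (s) => [//|d t IHt] h /=; apply: leq_add; first by apply: h; rewrite mem_head.
    by apply: IHt => a ta; apply: h; rewrite inE ta orbT.
  have lec := le c (mem_head _ _).
  move=> a; rewrite inE => /orP[/eqP ->|sa]; first lia.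
  by apply: IHs sa => [|b sb]; [lia | apply: le; rewrite inE sb orbT].
move=> e; case: (boolP (all (fun a => r a <= l a)%N s)) => [/allP le|/allPn[b sb nb]].
  by left; apply: key.
case: (boolP (all (fun a => l a <= r a)%N s)) => [/allP le|/allPn[a sa na]].
  by left=> a sa; apply/esym; apply: (key l r) => //.
by right; exists a, b; split=> //; rewrite ltnNge.
Qed.

Lemma even_pt_mem m u n : (0 < u)%N -> (3 * u + n.*2 + 1 <= m)%N -> even_pt u n \in shi_pts 6 m.
Proof.
move=> u0 um; rewrite /shi_pts mem_cat; apply/orP; right.
apply/allpairsPdep; exists (u.*2 + n)%N, n; rewrite !mem_iota /=; split; try lia.
rewrite /extra_pt; case: ltnP => [_|]; last by lia.
by rewrite addnK odd_double doubleK.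
Qed.

Lemma odd_pt_mem m u n : (3 * u + n + 2 <= m)%N -> odd_pt u n \in shi_pts 6 m.
Proof.
move=> um; rewrite /shi_pts mem_cat; apply/orP; right; apply/allpairsPdep.
have [le|lt] := leqP (3 * u + n.*2 + 2) m.
  exists (u.*2 + n + 1)%N, n; rewrite !mem_iota /=; split; try lia.
  rewrite /extra_pt; case: ltnP => [_|]; last by lia.
  have -> : (u.*2 + n + 1 - n = u.*2.+1)%N by lia.
  by rewrite /= odd_double uphalf_double.
exists (u.*2 + n + 1)%N, (m - (3 * u + n + 2))%N; rewrite !mem_iota /=; split; try lia.
rewrite /extra_pt; case: ltnP => [|_]; first by lia.
by congr odd_pt; lia.
Qed.

Lemma chain_pt_mem k m n h : (n <= m)%N -> (chain_bot k m n <= h <= k.-1 * m + n)%N ->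
  chain_pt n (chain_idx k m n h) \in shi_pts k m.
Proof.
move=> nm hh; rewrite /shi_pts mem_cat; apply/orP; left; apply/allpairsPdep.
by exists n, h; rewrite mem_iota mem_index_iota /= !ltnS; split.
Qed.

Lemma levels_forall (Q : nat * nat -> nat -> Prop) m P e1 e2 e3 e4 e5 e6 :
  levels 6 m P = [:: e1; e2; e3; e4; e5; e6] ->
  Q (1, 0)%N e1 -> Q (0, 1)%N e2 -> Q (1, 1)%N e3 -> Q (2, 1)%N e4 -> Q (3, 1)%N e5 ->
  Q (3, 2)%N e6 -> {in posroot_seq 6, forall a, Q a (level m P a)}.
Proof.
case=> <- <- <- <- <- <- q1 q2 q3 q4 q5 q6 a; rewrite !inE.
by case/or4P => [|||/or3P[]] /eqP ->.
Qed.

(** The inequalities bound a triangle whose lowest vertex is the crossing at [y = n + 1/2]: they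
    imply [y > n + 1/2] and [x > u - 1/3], which settles the levels of all roots. *)
Lemma even_pt_has_level m (x y : R) u n : (0 < u)%N -> (3 * u + n.*2 + 1 <= m)%N ->
  n%:R < y -> y < n.+1%:R -> x < u%:R -> (3 * u + n.*2 + 1)%:R < pair_val x y (3, 2)%N ->
  {in posroot_seq 6, forall a, has_level m (pair_val x y a) (level m (even_pt u n) a)}.
Proof.
move=> u0 um y1 y2 x1 xy.
have {}y2 : y < n%:R + 1 by rewrite natr1.
have uE : u.-1%:R = u%:R - 1 :> R by rewrite -[in RHS](prednK u0) -natr1 addrK.
move: xy; rewrite /pair_val /= -?muln2 ?(natrD, natrM) => xy.
apply: (levels_forall (Q := fun a r => has_level m (pair_val x y a) r)
  (even_pt_levels u0 um)); rewrite /pair_val /=.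
all: split; [lia | |move=> _; rewrite -[X in _ < X]natr1];
  rewrite -?muln2 ?(natrD, natrM) ?uE; lra.
Qed.

(** Here the two walls and [y < n + 1] confine [x] between [u] and [u + 1/2]. The wall of [(3, 2)]
    may lie beyond [m], so its level is a minimum. *)
Lemma odd_pt_has_level m (x y : R) u n : (3 * u + n + 2 <= m)%N ->
  n%:R < y -> y < n.+1%:R -> (u + n + 1)%:R < pair_val x y (1, 1)%N ->
  pair_val x y (3, 1)%N < (3 * u + n + 2)%:R ->
  {in posroot_seq 6, forall a, has_level m (pair_val x y a) (level m (odd_pt u n) a)}.
Proof.
move=> um y1 y2 xy1 xy2.
have {}y2 : y < n%:R + 1 by rewrite natr1.
move: xy1 xy2; rewrite /pair_val /= ?(natrD, natrM) => xy1 xy2.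
apply: (levels_forall (Q := fun a r => has_level m (pair_val x y a) r)
  (odd_pt_levels um)); rewrite /pair_val /=.
all: try by split; [lia | | move=> _; rewrite -[X in _ < X]natr1];
  rewrite -?muln2 ?(natrD, natrM); lra.
have v1 : (3 * u + n.*2 + 2)%:R < 3%:R * x + 2%:R * y.
  by rewrite -muln2 ?(natrD, natrM); lra.
have v2 : 3%:R * x + 2%:R * y < (3 * u + n.*2 + 2).+1%:R.
  by rewrite -[X in _ < X]natr1 -muln2 ?(natrD, natrM); lra.
split; first exact: geq_minl.
  by apply: le_lt_trans v1; rewrite ler_nat geq_minr.
by rewrite gtn_min ltnn /= => lt; rewrite (minn_idPr (ltnW lt)).
Qed.

Lemma posroot_seq_sub k a : a \in posroot_seq k -> a \in posroot_seq 6.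
Proof. exact: mem_take. Qed.

Lemma leq_sumn_map (T : eqType) (s : seq T) (f g : T -> nat) :
  {in s, forall a, (f a <= g a)%N} -> (sumn (map f s) <= sumn (map g s))%N.
Proof.
elim: s => [//|d t IHt] h /=; apply: leq_add; first by apply: h; rewrite mem_head.
by apply: IHt => a ta; apply: h; rewrite inE ta orbT.
Qed.

(** The point is compared with the chain point of the same strip and the same total height. If their
    levels differ, there are roots [a], [b] with [r a] below and [r b] above the chain levels, and
    [cross_walls] turns this into integer inequalities. *)
Lemma shi_pts_complete k m (x y : R) : k \in [:: 2; 3; 4; 6]%N -> 0 < x -> 0 < y ->
  {in posroot_seq k, forall a j, (1 <= j <= m)%N -> pair_val x y a != j%:R} ->
  exists2 P, P \in shi_pts k m &
    {in posroot_seq k, forall a, has_level m (pair_val x y a) (level m P a)}.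
Proof.
move=> hk x0 y0 off.
have pos : {in posroot_seq 6, forall a, 0 < pair_val x y a}.
  by move=> a; rewrite !inE /pair_val; case/or4P => [|||/or3P[]] /eqP -> /=; lra.
have /choice[r rP] : forall a, exists r, a \in posroot_seq k -> has_level m (pair_val x y a) r.
  move=> a; case: (boolP (a \in posroot_seq k)) => [ak|_]; last by exists 0%N.
  have [r hr] := @has_level_exists m _ (pos _ (posroot_seq_sub ak)) (off a ak).
  by exists r.
have mem01 : (0, 1)%N \in posroot_seq k by move: hk; rewrite !inE => /or4P[] /eqP ->.
have [n rn] : exists n, r (0, 1)%N = n by exists (r (0, 1)%N).
have [nm ny yn] := rP _ mem01.
rewrite /pair_val /= mul0r add0r mul1r rn in nm ny yn.
have lo : {in posroot_seq k, forall a, (minn m (a.2 * n) <= r a)%N}.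
  move=> a ak; apply: has_level_ge (rP a ak) _; rewrite natrM.
  move: (posroot_seq_sub ak); rewrite !inE /pair_val.
  by case/or4P => [|||/or3P[]] /eqP -> /=; lra.
have hi : {in posroot_seq k, forall a, (r a <= m)%N} by move=> a /rP[].
pose h := sumn (map r (posroot_seq k)).
have bot_h : (chain_bot k m n <= h)%N by rewrite chain_botE //; apply: leq_sumn_map.
have h_top : (h <= k.-1 * m + n)%N.
  move: hi; rewrite /h -rn; move: hk; rewrite !inE => /or4P[] /eqP -> /= h1.
  - have := h1 (1, 0)%N isT; lia.
  - have := h1 (1, 0)%N isT; have := h1 (1, 1)%N isT; lia.
  - have := h1 (1, 0)%N isT; have := h1 (1, 1)%N isT; have := h1 (2, 1)%N isT; lia.
  - have := h1 (1, 0)%N isT; have := h1 (1, 1)%N isT; have := h1 (2, 1)%N isT.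
    have := h1 (3, 1)%N isT; have := h1 (3, 2)%N isT; lia.
have hh : (chain_bot k m n <= h <= k.-1 * m + n)%N by rewrite bot_h.
have := chain_idxP hk nm hh; have := chain_pt_mem nm hh.
move: (chain_idx k m n h) => t memP eqh.
have [eqr|[a [b [ak bk ra rb]]]] := sumn_crossing (esym eqh).
  by exists (chain_pt n t) => // a ak; rewrite -eqr //; apply: rP.
have k6 : ((3, 2)%N \in posroot_seq k) || ((3, 1)%N \in posroot_seq k) -> k = 6%N.
  by move: hk; rewrite !inE => /or4P[] /eqP ->.
have la_m : (level m (chain_pt n t) a <= m)%N by apply: geq_minl.
have xa : pair_val x y a < (level m (chain_pt n t) a)%:R.
  by apply: has_level_lt (rP a ak) _; rewrite ra.
have [_ xb _] := rP b bk.
have cross : (0 < a.1)%N -> (0 < b.1)%N -> (n < m)%N ->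
  ((a.1 * b.2 <= b.1 * a.2)%N ->
     (a.1 * r b + (b.1 * a.2 - a.1 * b.2) * n < b.1 * level m (chain_pt n t) a)%N) /\
  ((b.1 * a.2 <= a.1 * b.2)%N ->
     (a.1 * r b < b.1 * level m (chain_pt n t) a + (a.1 * b.2 - b.1 * a.2) * n.+1)%N).
  by move=> a0 b0 ltn; apply: cross_walls xa xb ny (yn ltn).
have ra_lo := lo a ak; have rb_m := hi b bk.
have ca : (48 * level m (chain_pt n t) a <= a.1 * t.*2.+1 + a.2 * (48 * n + 12))%N.
  rewrite mulnC; apply: leq_trans (leq_trunc_div _ 48).
  by rewrite leq_mul2r geq_minr orbT.
have cb : (b.1 * t.*2.+1 + b.2 * (48 * n + 12) < 48 * r b)%N.
  rewrite [(48 * r b)%N]mulnC -ltn_divLR //.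
  move: rb; rewrite /level gtn_min => /orP[mb|qb]; last exact: qb.
  by have := leq_trans mb rb_m; rewrite ltnn.
(* The two pairs of roots that survive the case analysis, [ev] and [od], lead to the two kinds of
   extra point. *)
have ev : a = (1, 0)%N -> b = (3, 2)%N -> (n < m)%N ->
    r b = (3 * level m (chain_pt n t) a + n.*2 + 1)%N -> (0 < level m (chain_pt n t) a)%N ->
    exists2 P, P \in shi_pts k m &
      {in posroot_seq k, forall a, has_level m (pair_val x y a) (level m P a)}.
  move=> aE bE ltnm rbE l0; move: rb_m xa xb; rewrite rbE => rb_m xa xb.
  have -> : k = 6%N by apply: k6; rewrite -bE bk.
  exists (even_pt (level m (chain_pt n t) a) n); first exact: even_pt_mem.
  apply: even_pt_has_level => //; [exact: yn | | by rewrite -bE].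
  by move: xa; rewrite {1}aE /pair_val /= mul1r mul0r addr0.
have od : a = (3, 1)%N -> b = (1, 1)%N -> (n < m)%N -> (n < r b)%N ->
    level m (chain_pt n t) a = (3 * (r b - n - 1) + n + 2)%N ->
    exists2 P, P \in shi_pts k m &
      {in posroot_seq k, forall a, has_level m (pair_val x y a) (level m P a)}.
  move=> aE bE ltnm ltnr laE; rewrite laE in la_m xa.
  have -> : k = 6%N by apply: k6; rewrite -aE ak orbT.
  exists (odd_pt (r b - n - 1) n); first exact: odd_pt_mem.
  apply: odd_pt_has_level => //; [exact: yn | | by rewrite -aE].
  by rewrite -bE (_ : (r b - n - 1 + n + 1 = r b)%N) //; clear -ltnr; lia.
have six c : c \in posroot_seq 6 -> [\/ c = (0, 1)%N, c = (1, 0)%N | (0 < c.1)%N /\ (0 < c.2)%N].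
  by rewrite !inE; case/or4P => [|||/or3P[]] /eqP ->; [apply: Or32 | apply: Or31 | | | |]; try apply: Or33.
have a10 : (0 < a.1)%N.
  have [e|->//|[]//] := six a (posroot_seq_sub ak).
  by move: ra ca; rewrite e rn /=; clear; move: (level _ _ _) => l; lia.
have b10 : (0 < b.1)%N.
  have [e|->//|[]//] := six b (posroot_seq_sub bk).
  by move: cb; rewrite e rn /=; clear; lia.
(* In the top strip [y > m], so every root that involves [alpha_2] has level [m] at both points, and
   only [(1, 0)] could differ. *)
have a2b2 : (n < m)%N.
  rewrite ltn_neqAle nm andbT; apply/eqP => nm'.
  have [e|ea|[_ a2]] := six a (posroot_seq_sub ak); first by rewrite e in a10.
    have [e|eb|[_ b2]] := six b (posroot_seq_sub bk); first by rewrite e in b10.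
      by move: ra rb; rewrite ea eb; clear; lia.
    have : (48 * n <= b.2 * (48 * n + 12))%N.
      by apply: leq_trans (leq_pmull _ b2); apply: leq_addr.
    by move: cb rb_m; rewrite nm'; clear; lia.
  have : (n <= a.2 * n)%N by apply: leq_pmull.
  by move: ra_lo ra la_m; rewrite -nm'; move: (a.2 * n)%N; clear; lia.
have [c1 c2] := cross a10 b10 a2b2.
move: (posroot_seq_sub ak) (posroot_seq_sub bk) ev od.
move: ra a10 b10 ca cb c1 c2; move: (level m _ a) (r a) (r b) => i ra' j.
clear -a2b2; rewrite !inE => ra a10 b10 ca cb c1 c2.
case/or4P => [|||/or3P[]] /eqP aE; case/or4P => [|||/or3P[]] /eqP bE;
  move: a10 b10 ca cb c1 c2; rewrite aE bE /= => // _ _ ca cb c1 c2 ev od.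
all: try (exfalso; clear ev od; have := c1 isT; clear -ca cb; lia).
all: try (exfalso; clear ev od; have := c2 isT; clear -ca cb; lia).
- by apply: ev => //; have := c2 isT; clear -ca cb ra; lia.
- by apply: od => //; have := c2 isT; clear -ca cb ra; lia.
Qed.

End RealPoints.

(** * The positive roots computed from the Cartan matrix *)

Section Roots.

Definition vec2 (a b : int) : 'cV[int]_2 := \col_i (if i == 0 then a else b).

Definition root_vec (a : nat * nat) : 'cV[int]_2 := vec2 a.1%:Z a.2%:Z.

Lemma vec2_inj a b c d : vec2 a b = vec2 c d -> a = c /\ b = d.
Proof. by move/colP => h; have := h 0; have := h 1; rewrite !mxE /= => -> ->. Qed.

Lemma vec2E (v : 'cV[int]_2) : v = vec2 (v 0 0) (v 1 0).
Proof.
by apply/colP => i; rewrite mxE; case: i => -[|[|//]] i2 /=; congr (v _ _); apply: val_inj.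
Qed.

Lemma vec2_0 a b : vec2 a b 0 0 = a. Proof. by rewrite mxE. Qed.
Lemma vec2_1 a b : vec2 a b 1 0 = b. Proof. by rewrite mxE. Qed.

Lemma big_ord2 (V : nmodType) (F : 'I_2 -> V) : \sum_(i < 2) F i = F 0 + F 1.
Proof.
by rewrite !big_ord_recl big_ord0 addr0; congr (F _ + F _); apply: val_inj.
Qed.

Lemma refl_vec2 k a b :
  simple_refl k 0 *m vec2 a b = vec2 (- a - cartan k 0 1 * b) b /\
  simple_refl k 1 *m vec2 a b = vec2 a (- b - cartan k 1 0 * a).
Proof.
have mul2 i : simple_refl k i *m vec2 a b =
    vec2 (simple_refl k i 0 0 * a + simple_refl k i 0 1 * b)
         (simple_refl k i 1 0 * a + simple_refl k i 1 1 * b).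
  by rewrite [LHS]vec2E mxE [in X in vec2 _ X]mxE !big_ord2 !vec2_0 !vec2_1.
have c00 : cartan k 0 0 = 2 by rewrite mxE.
have c11 : cartan k 1 1 = 2 by rewrite mxE.
by rewrite !mul2 !simple_reflE /= c00 c11; split; congr vec2; lia.
Qed.

Definition signed_roots (k : nat) : seq (int * int) :=
  [seq (a.1%:Z, a.2%:Z) | a <- posroot_seq k] ++ [seq (- a.1%:Z, - a.2%:Z) | a <- posroot_seq k].

Lemma cartan_cases k : k \in [:: 2; 3; 4; 6]%N ->
  [\/ [/\ k = 2%N, cartan k 0 1 = 0 & cartan k 1 0 = 0],
      [/\ k = 3%N, cartan k 0 1 = -1 & cartan k 1 0 = -1],
      [/\ k = 4%N, cartan k 0 1 = -2 & cartan k 1 0 = -1] |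
      [/\ k = 6%N, cartan k 0 1 = -3 & cartan k 1 0 = -1]].
Proof.
by rewrite !inE => /or4P[] /eqP ->; [apply: Or41 | apply: Or42 | apply: Or43 | apply: Or44];
  rewrite !mxE.
Qed.

Lemma signed_roots_refl k a b : k \in [:: 2; 3; 4; 6]%N -> (a, b) \in signed_roots k ->
  (- a - cartan k 0 1 * b, b) \in signed_roots k /\ (a, - b - cartan k 1 0 * a) \in signed_roots k.
Proof.
move=> hk; pose L k := signed_roots k.
pose ok k (c d : int) := all (fun p : int * int => ((- p.1 - c * p.2, p.2) \in L k) &&
  ((p.1, - p.2 - d * p.1) \in L k)) (L k).
suff : ok k (cartan k 0 1) (cartan k 1 0) by move/allP => h /h /andP[].
by case: (cartan_cases hk) => -[-> -> ->].
Qed.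

Lemma roots_refl k i v : Defs.roots k v -> Defs.roots k (simple_refl k i *m v).
Proof.
case=> M [j [[s ->] ->]]; exists (\prod_(i <- i :: s) simple_refl k i), j; split.
  by exists (i :: s).
by rewrite big_cons mulmxA.
Qed.

Lemma roots_simple k : Defs.roots k (vec2 1 0) /\ Defs.roots k (vec2 0 1).
Proof.
have h i : Defs.roots k (simple_root i).
  by exists 1%:M, i; split; [exists [::]; rewrite big_nil | rewrite mul1mx].
by split; [have := h 0 | have := h 1]; rewrite [simple_root _]vec2E !mxE.
Qed.

Lemma roots_signed k v : k \in [:: 2; 3; 4; 6]%N -> Defs.roots k v -> (v 0 0, v 1 0) \in signed_roots k.
Proof.
move=> hk [M [j [[s ->] ->]]]; elim: s => [|i s IHs].
  rewrite big_nil mul1mx !mxE.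
  by move: hk; rewrite !inE => /or4P[] /eqP ->; case: j => -[|[|//]].
rewrite big_cons -[_ * _]/(_ *m _) -mulmxA; move: IHs; set w := _ *m simple_root j.
rewrite [w in _ *m w]vec2E => /(signed_roots_refl hk)[h0 h1].
have [e0 e1] := refl_vec2 k (w 0 0) (w 1 0).
have [->|->] : i = 0 \/ i = 1.
- by case: i => -[|[|//]] i2; [left | right]; apply: val_inj.
- by rewrite e0 vec2_0 vec2_1.
- by rewrite e1 vec2_0 vec2_1.
Qed.

Lemma posrootsP k v : k \in [:: 2; 3; 4; 6]%N ->
  posroots k v <-> exists2 a, a \in posroot_seq k & v = root_vec a.
Proof.
move=> hk; split.
  case=> /(roots_signed hk); rewrite mem_cat => /orP[] /mapP[a ak [v0 v1]] pos.
    by exists a => //; rewrite [v]vec2E v0 v1.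
  have := pos 0; have := pos 1; rewrite v0 v1 !oppr_ge0 !lez_nat !leqn0 => /eqP a2 /eqP a1.
  exists a => //; rewrite [v]vec2E v0 v1 /root_vec; congr vec2; lia.
case=> a ak ->; split; last first.
  by case=> -[|[|//]] i2; rewrite mxE.
have [r10 r01] := roots_simple k.
have R0 x y : Defs.roots k (vec2 x y) -> Defs.roots k (vec2 (- x - cartan k 0 1 * y) y).
  by move/(@roots_refl k 0); have [-> _] := refl_vec2 k x y.
have R1 x y : Defs.roots k (vec2 x y) -> Defs.roots k (vec2 x (- y - cartan k 1 0 * x)).
  by move/(@roots_refl k 1); have [_ ->] := refl_vec2 k x y.
case: (cartan_cases hk) => -[kE c01 c10]; rewrite c01 c10 in R0 R1; move: ak; rewrite {1}kE !inE.
- by case/orP => /eqP ->.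
- by case/or3P => /eqP -> //; apply: (R0 _ _ r01).
- case/or4P => /eqP -> //; first exact: (R1 _ _ r10).
  exact: (R0 _ _ r01).
- have r11 := R1 _ _ r10; have r31 := R0 _ _ r01.
  case/or4P => [|||/or3P[]] /eqP -> //; [exact: (R0 _ _ r11) | exact: (R1 _ _ r31)].
Qed.

End Roots.

(** * Shi regions as connected components *)

Section Regions.
Variable R : realType.
Variables k m : nat.
Hypotheses (hk : k \in [:: 2; 3; 4; 6]%N) (m1 : (1 <= m)%N).
Local Notation V := 'rV[R]_2.
Local Notation val x a := (pair_val (x 0 0) (x 0 1) a).
Local Notation compl := (@shi_complement R k m).
Local Notation comp x := (connected_component (@shi_complement R k m) x).

Lemma pairing_root_vec a (x : V) : pairing (root_vec a) x = val x a.
Proof. by rewrite /pairing big_ord2 !mxE. Qed.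

Lemma complP (x : V) : compl x <->
  {in posroot_seq k, forall a (j : int), - m%:Z < j <= m%:Z -> val x a != j%:~R}.
Proof.
split=> h.
  move=> a ak j jm; rewrite -pairing_root_vec; apply: (h (root_vec a, j)); split=> //.
  by apply/(posrootsP _ hk); exists a.
case=> v j [] /= /(posrootsP _ hk)[a ak ->] jm.
by rewrite pairing_root_vec; apply: h.
Qed.

Lemma dominantP (x : V) : dominant_cone k x <-> {in posroot_seq k, forall a, 0 < val x a}.
Proof.
split=> h.
  move=> a ak; rewrite -pairing_root_vec; apply: h.
  by apply/(posrootsP _ hk); exists a.
move=> v /(posrootsP _ hk)[a ak ->].
by rewrite pairing_root_vec; apply: h.
Qed.

Lemma val_continuous a : continuous (fun x : V => val x a : R).
Proof.
move=> x; rewrite /pair_val.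
apply: (@continuousD R R^o V (fun x : V => a.1%:R * x 0 0) (fun x : V => a.2%:R * x 0 1)).
  apply: (@continuousM R V (fun=> a.1%:R) (fun x => x 0 0)); first exact: cst_continuous.
  exact: coord_continuous.
apply: (@continuousM R V (fun=> a.2%:R) (fun x => x 0 1)); first exact: cst_continuous.
exact: coord_continuous.
Qed.

(** The values of [a] on a component form an interval that misses [j]. *)
Lemma comp_side (x y : V) a (j : int) : a \in posroot_seq k -> - m%:Z < j <= m%:Z ->
  comp x y -> (val x a < j%:~R) = (val y a < j%:~R).
Proof.
move=> ak jm xy.
have yx := connected_component_sym xy.
have : connected ((fun x : V => val x a) @` comp x)%classic.
  apply: connected_continuous_connected; first exact: component_connected.
  by apply: continuous_subspaceT; apply: val_continuous.
move/connected_intervalP => itv.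
have cx : comp x x by apply: connected_component_refl; apply: connected_component_sub yx.
have off z : comp x z -> val z a != j%:~R.
  by move/(@connected_component_sub _ _ _ _)/complP; apply.
have key (u v : V) : comp x u -> comp x v -> val u a < j%:~R -> val v a < j%:~R.
  move=> cu cv uj; rewrite ltNge; apply/negP => vj.
  have [z cz /eqP] : ((fun x : V => val x a) @` comp x)%classic (j%:~R : R).
    by apply: (itv (val u a) (val v a)); [exists u | exists v | rewrite (ltW uj)].
  by rewrite (negPf (off z cz)).
by apply/idP/idP; apply: key.
Qed.

Lemma segment_comp (x y : V) :
  (forall t : R, 0 <= t <= 1 -> compl (x + t *: (y - x))) -> comp x = comp y.
Proof.
move=> seg; apply: same_connected_component.
pose f (t : R) : V := x + t *: (y - x).
apply: (@connected_component_max _ _ (f @` `[0, 1]%classic)%classic).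
- by exists 0; rewrite /f /= ?scale0r ?addr0 // in_itv /= lexx ler01.
- by move=> _ [t t01 <-]; apply: seg; move: t01; rewrite /= in_itv.
- apply: connected_continuous_connected; first exact: segment_connected.
  apply: continuous_subspaceT => t; apply: (@continuousD R V R^o (fun=> x) (fun t => t *: (y - x))).
    exact: cst_continuous.
  exact: scalel_continuous.
- by exists 1; rewrite /f /= ?scale1r ?[x + _]addrC ?subrK // in_itv /= lexx ler01.
Qed.

(** Prescribed levels define a convex cell, so the segment from [x] to [y] meets no wall; the walls
    with [j <= 0] are avoided by positivity. *)
Lemma same_levels_comp (x y : V) (r : nat * nat -> nat) :
  {in posroot_seq k, forall a, 0 < val x a /\ 0 < val y a} ->
  {in posroot_seq k, forall a, has_level m (val x a) (r a)} ->
  {in posroot_seq k, forall a, has_level m (val y a) (r a)} -> comp x = comp y.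
Proof.
move=> pos lx ly; apply: segment_comp => t /andP[t0 t1]; apply/complP => a ak j /andP[_ jm].
have -> : val (x + t *: (y - x)) a = (1 - t) * val x a + t * val y a.
  by rewrite !mxE /pair_val; ring.
have conv (c : R) : (c < val x a -> c < val y a -> c < (1 - t) * val x a + t * val y a) /\
    (val x a < c -> val y a < c -> (1 - t) * val x a + t * val y a < c).
  move: (val x a) (val y a) => u v.
  have [->|tn1] := eqVneq t 1; first by rewrite subrr mul0r add0r mul1r.
  have t1' : 0 < 1 - t by rewrite subr_gt0 lt_neqAle tn1.
  split=> h1 h2; rewrite -subr_gt0 in h1; rewrite -subr_gt0 in h2.
    by have := mulr_gt0 t1' h1; have := mulr_ge0 t0 (ltW h2); lra.
  by have := mulr_gt0 t1' h1; have := mulr_ge0 t0 (ltW h2); lra.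
have [px py] := pos a ak.
have [_ xr xr1] := lx a ak; have [_ yr yr1] := ly a ak.
case: j jm => j jm; last first.
  rewrite gt_eqF //; apply: lt_trans (proj1 (conv 0) px py).
  by rewrite ltrz0.
have [jr|rj] := leqP j (r a).
  rewrite gt_eqF //; apply: le_lt_trans (proj1 (conv (r a)%:R) xr yr).
  by rewrite -[j%:~R]/(j%:R) ler_nat.
have rm : (r a < m)%N by apply: leq_trans rj _; rewrite -lez_nat.
rewrite lt_eqF //; apply: lt_le_trans (proj2 (conv (r a).+1%:R) (xr1 rm) (yr1 rm)) _.
by rewrite -[j%:~R]/(j%:R) ler_nat.
Qed.

Definition lattice_pt (P : nat * nat) : V := \row_i ((if i == 0 then P.1 else P.2)%:R / 48%:R).

Lemma val_lattice P a : val (lattice_pt P) a = (a.1 * P.1 + a.2 * P.2)%:R / 48%:R.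
Proof. by rewrite !mxE /pair_val /= natrD !natrM; ring. Qed.

Lemma shi_pts_offwall P a : P \in shi_pts k m -> a \in posroot_seq k ->
  ((a.1 * P.1 + a.2 * P.2) %% 48 != 0)%N.
Proof.
move=> Pin /posroot_seq_sub; rewrite !inE.
move: Pin; rewrite mem_cat => /orP[/allpairsPdep[n [h [_ _ ->]]]|].
  rewrite /chain_pt; move: (chain_idx _ _ _ _) => t.
  by case/or4P => [|||/or3P[]] /eqP -> /=; lia.
case: ifP => // _ /allpairsPdep[v [s [_ hs ->]]].
rewrite mem_iota /= add0n in hs.
have [u [n [[u0 um -> _ _]|[um -> _ _]|[mu um -> _ _]]]] := extra_ptP hs;
  rewrite /even_pt /odd_pt; case/or4P => [|||/or3P[]] /eqP -> /=; lia.
Qed.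

Lemma lattice_has_level P a : P \in shi_pts k m -> a \in posroot_seq k ->
  has_level m (val (lattice_pt P) a) (level m P a).
Proof.
move=> Pin ak; have := shi_pts_offwall Pin ak; rewrite val_lattice /level.
set Q := (_ + _)%N => Q48.
have p48 : 0 < 48%:R :> R by rewrite ltr0n.
split; first exact: geq_minl.
  by rewrite ltr_pdivlMr // -natrM ltr_nat; have := geq_minr m (Q %/ 48); lia.
move=> lt; rewrite ltr_pdivrMr // -natrM ltr_nat; lia.
Qed.

Lemma lattice_pos P a : P \in shi_pts k m -> a \in posroot_seq k -> 0 < val (lattice_pt P) a.
Proof.
move=> Pin ak; have := shi_pts_offwall Pin ak; rewrite val_lattice => Q48.
by rewrite divr_gt0 ?ltr0n // lt0n; apply: contraNneq Q48 => ->.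
Qed.

Lemma lattice_compl P : P \in shi_pts k m -> compl (lattice_pt P).
Proof.
move=> Pin; apply/complP => a ak j _; case: j => j; last first.
  by rewrite gt_eqF // (lt_trans _ (lattice_pos Pin ak)) // ltrz0.
have := shi_pts_offwall Pin ak; rewrite val_lattice -[j%:~R]/(j%:R).
apply: contraNneq => e; have /eqP : (a.1 * P.1 + a.2 * P.2)%:R = (j * 48)%:R :> R.
  by rewrite natrM -e divfK // pnatr_eq0.
by rewrite eqr_nat => /eqP ->; rewrite modnMl.
Qed.

Lemma level_eq (v v' : R) r r' : has_level m v r -> has_level m v' r' ->
  (forall j, (0 < j <= m)%N -> (v < j%:R) = (v' < j%:R)) -> r = r'.
Proof.
have key (w w' : R) s s' : has_level m w s -> has_level m w' s' ->
    (forall j, (0 < j <= m)%N -> (w < j%:R) = (w' < j%:R)) -> (s' <= s)%N.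
  move=> hs [s'm s'w _] e; rewrite leqNgt; apply/negP => ss'.
  have := has_level_lt hs (i := s'); rewrite ss' s'm => /(_ isT).
  rewrite e; last by rewrite s'm andbT; apply: leq_trans ss'.
  by rewrite ltNge (ltW s'w).
move=> h h' e; apply/eqP; rewrite eqn_leq (key _ _ _ _ h h' e) andbT.
by apply: (key _ _ _ _ h' h) => j jm; rewrite e.
Qed.

Definition shi_region (P : nat * nat) : set V := comp (lattice_pt P).

Lemma shi_region_side P y a (j : int) : P \in shi_pts k m -> a \in posroot_seq k ->
  - m%:Z < j <= m%:Z -> shi_region P y -> (val y a < j%:~R) = (val (lattice_pt P) a < j%:~R).
Proof. by move=> Pin ak jm Py; rewrite -(comp_side ak jm Py). Qed.

Lemma shi_region_refl P : P \in shi_pts k m -> shi_region P (lattice_pt P).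
Proof. by move=> Pin; apply/connected_component_refl/lattice_compl. Qed.

Lemma shi_region_dominant P y : P \in shi_pts k m -> shi_region P y -> dominant_cone k y.
Proof.
move=> Pin Py; apply/dominantP => a ak.
(* Since [1 <= m], the walls [j = 0] belong to the arrangement, so a region cannot leave the
   dominant cone. *)
have z_m : - m%:Z < 0 <= m%:Z by lia.
have := shi_region_side Pin ak z_m Py; rewrite [RHS]ltNge (ltW (lattice_pos Pin ak)) /= => /negbT.
rewrite -leNgt le_eqVlt => /orP[/eqP e|//].
have /complP/(_ a ak 0 z_m) := connected_component_sub Py.
by rewrite -e eqxx.
Qed.

Lemma pos_shi_regionsE : pos_shi_regions k m = [set` [seq shi_region P | P <- shi_pts k m]]%classic.
Proof.
apply/seteqP; split=> [Rg [[x cx <-] xdom]|Rg /= /mapP[P Pin ->]]; last first.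
  split; first by exists (lattice_pt P) => //; apply: lattice_compl.
  by move=> y; apply: shi_region_dominant.
have /dominantP dx := xdom x (connected_component_refl cx).
have mem10 : (1, 0)%N \in posroot_seq k by move: hk; rewrite !inE => /or4P[] /eqP ->.
have mem01 : (0, 1)%N \in posroot_seq k by move: hk; rewrite !inE => /or4P[] /eqP ->.
have x0 : 0 < x 0 0 by have := dx _ mem10; rewrite /pair_val mul1r mul0r addr0.
have x1 : 0 < x 0 1 by have := dx _ mem01; rewrite /pair_val mul1r mul0r add0r.
have off : {in posroot_seq k, forall a j, (1 <= j <= m)%N -> val x a != j%:R}.
  by move=> a ak j jm; apply: (proj1 (complP x) cx a ak j%:Z); lia.
have [P Pin lP] := shi_pts_complete hk x0 x1 off.
apply/mapP; exists P => //; apply: (same_levels_comp (r := level m P)) => //.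
  by move=> a ak; split; [apply: dx | apply: lattice_pos].
by move=> a ak; apply: lattice_has_level.
Qed.

Lemma shi_region_levels P P' : P \in shi_pts k m -> P' \in shi_pts k m ->
  shi_region P = shi_region P' -> levels k m P = levels k m P'.
Proof.
move=> Pin Pin' e; apply/eq_in_map => a ak.
apply: level_eq (lattice_has_level Pin ak) (lattice_has_level Pin' ak) _ => j jm.
have PP' : shi_region P (lattice_pt P') by rewrite e; apply: shi_region_refl.
by rewrite -[j%:R]/(j%:Z%:~R) (shi_region_side Pin ak _ PP') //; lia.
Qed.

Lemma shi_regions_uniq : uniq [seq shi_region P | P <- shi_pts k m].
Proof.
have ul := levels_uniq m hk.
rewrite map_inj_in_uniq; first exact: map_uniq ul.
move=> P P' Pin Pin' /(shi_region_levels Pin Pin').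
move: ul Pin Pin'; elim: (shi_pts k m) => [//|Q s IHs] /= /andP[Qs us].
rewrite !inE => /orP[/eqP ->|Ps] /orP[/eqP ->|Ps'] e //.
- by case/negP: Qs; rewrite e map_f.
- by case/negP: Qs; rewrite -e map_f.
- exact: IHs.
Qed.

End Regions.

(** * Heights of the regions and the comparison of the sums *)

Section Height.
Variable R : realType.
Variables k m : nat.
Hypotheses (hk : k \in [:: 2; 3; 4; 6]%N) (m1 : (1 <= m)%N).
Local Notation V := 'rV[R]_2.
Local Notation val x a := (pair_val (x 0 0) (x 0 1) a).

(** The coordinates [1/8] are small enough because the coefficients of a positive root add up to at
    most 5. *)
Lemma fund_alcove_pt : fund_alcove k (const_mx (8%:R^-1) : V).
Proof.
move=> v /(posrootsP _ hk)[a ak ->]; rewrite pairing_root_vec /pair_val !mxE.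
by move: (posroot_seq_sub ak); rewrite !inE; case/or4P => [|||/or3P[]] /eqP -> /=; lra.
Qed.

Definition wall_seq (P : nat * nat) : seq ('cV[int]_2 * int) :=
  [seq (root_vec a, j%:Z) | a <- posroot_seq k, j <- iota 1 (level m P a)].

Lemma root_vec_inj : injective root_vec.
Proof. by move=> [a b] [c d] /vec2_inj [/= [->] [->]]. Qed.

Lemma posroot_seq_uniq : uniq (posroot_seq k).
Proof. exact: take_uniq. Qed.

Lemma wall_seq_uniq P : uniq (wall_seq P).
Proof.
apply: allpairs_uniq_dep; [exact: posroot_seq_uniq | by move=> a _; apply: iota_uniq |].
move=> _ _ /allpairsPdep[a [j [_ _ ->]]] /allpairsPdep[a' [j' [_ _ ->]]] /=.
by case=> /root_vec_inj -> ->.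
Qed.

(** Walls with [j <= 0] have both the region and the alcove above them. A wall with the region below
    and the alcove above would need [0 < j < 1], so only the walls from 1 to the level of each root
    separate. *)
Lemma separatesE P : P \in shi_pts k m ->
  (shi_hyps k m `&` separates k (@shi_region R k m P) = [set` wall_seq P])%classic.
Proof.
move=> Pin; have cP : shi_region k m P (lattice_pt R P) by apply: shi_region_refl.
have fp := fund_alcove_pt.
apply/seteqP; split=> [[v j] [[/= pv jm] sep]|[v j] /= /allpairsPdep[a [i [ak im [-> ->]]]]].
  have [a ak vE] := proj1 (posrootsP _ hk) pv; subst v.
  have lP : has_level m (val (lattice_pt R P) a) (level m P a) by apply: (@lattice_has_level _ k m).
  have p0 : 0 < val (lattice_pt R P) a by apply: (@lattice_pos _ k m).
  have /andP[f0 f1] := fp _ pv.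
  case: sep => -[/(_ _ cP) /= s1 /(_ _ fp) /= s2].
    rewrite pairing_root_vec in s1.
    have j1 : j%:~R < 1 :> R := lt_trans s2 f1.
    have j0 : 0 < j%:~R :> R := lt_trans p0 s1.
    by move: j1 j0; rewrite ltrz1 ltr0z; lia.
  rewrite pairing_root_vec in s1.
  have j0 : 0 < j%:~R :> R := lt_trans f0 s2.
  rewrite ltr0z in j0; case: j j0 jm s1 s2 => // j j0 jm s1 s2.
  have jm' : (j <= m)%N by lia.
  apply/allpairsPdep; exists a, j; split=> //; rewrite mem_iota add1n ltnS.
  apply/andP; split; first by lia.
  rewrite leqNgt; apply/negP => lt; have := has_level_lt lP (i := j).
  by rewrite lt jm' => /(_ isT); rewrite ltNge (ltW s1).
rewrite mem_iota add1n ltnS in im; case/andP: im => i1 il.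
have im : (i <= m)%N by apply: leq_trans il _; apply: geq_minl.
have iz : - m%:Z < i%:Z <= m%:Z by lia.
have pv : posroots k (root_vec a) by apply/(posrootsP _ hk); exists a.
split; first by [].
right; split=> y /=.
  move=> Py; rewrite pairing_root_vec.
  have := shi_region_side hk Pin ak iz Py.
  have [_ lP _] : has_level m (val (lattice_pt R P) a) (level m P a) by apply: (@lattice_has_level _ k m).
  rewrite [RHS]ltNge (ltW (le_lt_trans _ lP)) ?ler_nat //= => /negbT.
  rewrite -leNgt le_eqVlt => /orP[/eqP e|//].
  have /(proj1 (complP m hk y))/(_ a ak i%:Z iz) := connected_component_sub Py.
  by rewrite -e eqxx.
move=> /(_ _ pv) /andP[_ lt1]; apply: lt_le_trans lt1 _.
by rewrite -[i%:Z%:~R]/(i%:R) ler1n.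
Qed.

Lemma height_shi_region P : P \in shi_pts k m ->
  height k m (@shi_region R k m P) = sumn (levels k m P).
Proof.
move=> Pin; rewrite /height separatesE // -fsbig_seq ?wall_seq_uniq //.
rewrite sum1_size /wall_seq size_allpairs_dep /levels; congr sumn.
by apply: eq_map => a; rewrite size_iota.
Qed.

Lemma nposrootsE : nposroots k = k.
Proof.
have -> : nposroots k = size (map root_vec (posroot_seq k)).
  rewrite -sum1_size fsbig_seq ?map_inj_uniq ?posroot_seq_uniq //; last exact: root_vec_inj.
  congr (\sum_(i \in _) _)%N; apply/seteqP; split=> v /=.
    by case/(posrootsP _ hk) => a ak ->; apply: map_f.
  by case/mapP => a ak ->; apply/(posrootsP _ hk); exists a.
by rewrite size_map; move: hk; rewrite !inE => /or4P[] /eqP ->.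
Qed.

Lemma shi_coh_sumE :
  shi_coh_sum R k m = \sum_(P <- shi_pts k m) 'X^(m * k - sumn (levels k m P)).
Proof.
rewrite /shi_coh_sum pos_shi_regionsE // -fsbig_seq ?shi_regions_uniq // big_map.
by apply: eq_big_seq => P Pin; rewrite /coh nposrootsE height_shi_region.
Qed.

End Height.

Theorem theorem3p19 (R : realType) (k m : nat) :
  k \in [:: 2; 3; 4; 6]%N -> (1 <= m)%N ->
  Cat_q1 R k m = shi_coh_sum R k m.
Proof. by move=> hk m1; rewrite Cat_q1E // shi_coh_sumE // shi_pts_sum. Qed.
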